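(* Let $q$ be a power of a prime $p$, let $0\le j\le q-2$, $n=j+2$, and put $k=2j+2+(n-1)(q-1)$ and $m\equiv j+1\pmod{q-1}$. Let $M,D,A,F,T$ be the $n\times n$ matrices over $\mathbb{C}_\infty$ defined in the context. Then all of the following hold: 1. $\mathrm{Ker}(MA)\cap\mathrm{Ker}(F+MD)=\mathrm{Ker}(MA)\cap F(\mathrm{Ker}(I+MA))=0$; 2. if $q$ is odd, $MD$ is diagonalizable; if $q$ is even, $MD$ is diagonalizable if and only if $\dim_{\mathbb{C}_\infty}S^{1,new}_{k,m}(\Gamma_0(t))\le1$; 3. $S^1_{k,m}(\Gamma_0(t))=S^{1,old}_{k,m}(\Gamma_0(t))\oplus S^{1,new}_{k,m}(\Gamma_0(t))=(\mathrm{Ker}(MA)\oplus\mathrm{Ker}(MD))\oplus(\mathrm{Ker}(T)\cap F\,\mathrm{Ker}(T))$, where $S^1_{k,m}(\Gamma_0(t))$ is identified with $\mathbb{C}_\infty^n$ via the basis described in the context.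
   Context: Modular forms. $K=\mathbb{F}_q(t)$, $K_\infty$ is its completion at $\infty=1/t$, $\mathbb{C}_\infty$ is the completion of an algebraic closure of $K_\infty$, and $\Omega=\mathbb{P}^1(\mathbb{C}_\infty)-\mathbb{P}^1(K_\infty)$ is the Drinfeld upper half plane. For $\gamma=\begin{pmatrix}a&b\\c&d\end{pmatrix}\in GL_2(K_\infty)$ and $\varphi:\Omega\to\mathbb{C}_\infty$ put $(\varphi|_{k,m}\gamma)(z)=\varphi(\gamma z)(\det\gamma)^m(cz+d)^{-k}$. For $\Gamma=GL_2(\mathbb{F}_q[t])$ or $\Gamma=\Gamma_0(t)=\{\begin{pmatrix}a&b\\c&d\end{pmatrix}\in GL_2(\mathbb{F}_q[t]): c\equiv0 \bmod t\}$, $S^1_{k,m}(\Gamma)$ is the (finite dimensional) $\mathbb{C}_\infty$-space of cusp forms of weight $k$ and type $m$: rigid analytic $\varphi:\Omega\to\mathbb{C}_\infty$ with $\varphi|_{k,m}\gamma=\varphi$ for all $\gamma\in\Gamma$, holomorphic and vanishing at all cusps. It depends on $m$ only modulo $q-1$. The Atkin operator on $S^1_{k,m}(\Gamma_0(t))$ is $\mathbf{U}_t(\varphi)(z)=\sum_{b\in\mathbb{F}_q}\varphi\left(\frac{z+b}{t}\right)$; the Hecke operator on $S^1_{k,m}(GL_2(\mathbb{F}_q[t]))$ is $\mathbf{T}_t(\varphi)(z)=t^k\varphi(tz)+\sum_{b\in\mathbb{F}_q}\varphi\left(\frac{z+b}{t}\right)$ (item 1 is the matrix form of $\mathrm{Ker}(\mathbf{T}_t)=0$).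 Oldforms: let $\delta_1,\delta_t:S^1_{k,m}(GL_2(\mathbb{F}_q[t]))\to S^1_{k,m}(\Gamma_0(t))$ be $\delta_1(\varphi)=\varphi$, $\delta_t(\varphi)(z)=t^m\varphi(tz)$, and $\delta(\varphi,\psi)=\delta_1\varphi+\delta_t\psi$; then $S^{1,old}_{k,m}(\Gamma_0(t))=\mathrm{Im}(\delta)$. Newforms: let $\varphi^{Fr}=\varphi|_{k,m}\begin{pmatrix}0&-1\\t&0\end{pmatrix}$ (Fricke involution), $Tr(\varphi)=\sum_{\gamma\in R}\varphi|_{k,m}\gamma$ with $R=\{\mathrm{Id}\}\cup\{\begin{pmatrix}0&-1\\1&b\end{pmatrix}:b\in\mathbb{F}_q\}$, and $Tr'(\varphi)=Tr(\varphi^{Fr})$; then $S^{1,new}_{k,m}(\Gamma_0(t))=\mathrm{Ker}(Tr)\cap\mathrm{Ker}(Tr')$. Basis. Let $\Gamma_1(t)\subset\Gamma_0(t)$ be the subgroup with diagonal entries $\equiv1 \bmod t$. Teitelbaum's residue isomorphism identifies $S^1_{k,m}(\Gamma_1(t))$ with the harmonic cocycles of weight $k$ for $\Gamma_1(t)$: functions $\mathbf{c}$ from oriented edges of the Bruhat-Tits tree of $GL_2(K_\infty)$ (edges $=GL_2(K_\infty)/Z(K_\infty)\mathcal{I}(K_\infty)$, with $\mathcal{I}$ the Iwahori subgroup) to the dual of $V=\bigoplus_{i=0}^{k-2}\mathbb{C}_\infty X^iY^{k-2-i}$ which are harmonic, antisymmetric under edge reversal, and $\Gamma_1(t)$-equivariant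 for the action $(\gamma\omega)(X^iY^{k-2-i})=\det(\gamma)^{1-m}\omega((aX+bY)^i(cX+dY)^{k-2-i})$. Such a cocycle is determined by its value on the edge $\bar e$ represented by $\begin{pmatrix}0&1\\1&0\end{pmatrix}$, and a basis is $\mathbf{c}_0,\dots,\mathbf{c}_{k-2}$ where $\mathbf{c}_i(\bar e)(X^lY^{k-2-l})=1$ if $l=i$ and $0$ otherwise. For $k,j,n,m$ as in the claim, $S^1_{k,m}(\Gamma_0(t))$ has basis $\mathbf{c}_{j+(b-1)(q-1)}$, $1\le b\le n$. Matrices (size $n\times n$). $M=(m_{a,b})$ has entries in $\mathbb{F}_p$: $$m_{a,b}=-\left[\binom{j+(n-a)(q-1)}{j+(n-b)(q-1)}+(-1)^{j+1}\binom{j+(n-a)(q-1)}{j+(b-1)(q-1)}\right]\ (a\ne b),\qquad m_{a,a}=(-1)^j\binom{j+(n-a)(q-1)}{j+(a-1)(q-1)},$$ with $\binom{x}{y}=0$ if $y>x$. With $s_i=j+1+(i-1)(q-1)$: $D=\mathrm{diag}(t^{s_1},\dots,t^{s_n})$; $F$ is the antidiagonal matrix whose entry in row $n+1-b$, column $b$ is $(-t)^{s_b}$; $A$ is the antidiagonal matrix with all antidiagonal entries $(-1)^{j+1}$; $I$ is the identity; $T=I+MA$. In the basis $\mathbf{c}_{j+(b-1)(q-1)}$, $1\le b\le n$, of $S^1_{k,m}(\Gamma_0(t))$ (column convention), $\mathbf{U}_t$ has matrix $MD$, the Fricke involution has matrix $t^{m-k}F$, $Tr$ has matrix $T$, and $Tr'$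 has matrix $t^{m-k}(F+MD)$; moreover $\mathrm{Im}(\delta_1)=\mathrm{Ker}(MA)$, $\mathrm{Im}(\delta_t)=\mathrm{Ker}(MD)$ and newforms are $\mathrm{Ker}(T)\cap F(\mathrm{Ker}(T))$. *)

(* Defs.v *)
From HB Require Import structures.
From mathcomp Require Export all_boot all_order all_algebra.
From mathcomp Require Export all_classical all_reals.

Set Implicit Arguments.
Unset Strict Implicit.
Unset Printing Implicit Defensive.

Import Order.TTheory GRing.Theory Num.Theory.
Local Open Scope classical_set_scope.
Local Open Scope ring_scope.

(** * Linear algebra in a possibly infinite-dimensional module *)

Section LinearAlgebra.
Variables (K : fieldType) (W : lmodType K).
Implicit Types V A B : set W.

Definition lin_comb n (e : 'I_n -> W) (x : 'cV[K]_n) : W :=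
  \sum_i x i 0 *: e i.

Definition is_basis V n (e : 'I_n -> W) : Prop :=
  (forall x, V (lin_comb e x)) /\
  (forall v, V v -> exists! x, v = lin_comb e x).

(* Column convention: the b-th column holds the coordinates of L (e b). *)
Definition has_matrix n (e : 'I_n -> W) (L : W -> W) (B : 'M[K]_n) : Prop :=
  forall b, L (e b) = lin_comb e (col b B).

Definition dim_le V (d : nat) : Prop :=
  exists d', (d' <= d)%N /\ exists e : 'I_d' -> W, is_basis V e.

Definition sum_set A B : set W := [set a + b | a in A & b in B].

Definition is_direct_sum V A B : Prop :=
  V = sum_set A B /\ A `&` B = [set 0].

End LinearAlgebra.

Definition Ker (K : fieldType) n (B : 'M[K]_n) : set 'cV[K]_n :=
  [set x | B *m x = 0].

Definition mx2 (T : Type) (a b c d : T) : 'M[T]_2 :=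
  \matrix_(i, l) (if i == 0 then (if l == 0 then a else b)
                            else (if l == 0 then c else d)).

(** * The field C_oo *)

Definition rat_fun (Fq : finFieldType) := {fraction {poly Fq}}.

Section AbsoluteValue.
Variables (R : realType) (C : fieldType) (absv : C -> R).

Definition abs_cvg (u : nat -> C) (l : C) : Prop :=
  forall eps, 0 < eps ->
    exists N, forall i, (N <= i)%N -> absv (u i - l) < eps.

Definition abs_cauchy (u : nat -> C) : Prop :=
  forall eps, 0 < eps ->
    exists N, forall i l, (N <= i)%N -> (N <= l)%N -> absv (u i - u l) < eps.

Definition abs_closure (S : set C) : set C :=
  [set z | forall eps, 0 < eps -> exists2 x, S x & absv (z - x) < eps].

Definition algebraic_over (S : set C) (y : C) : Prop :=
  exists P : {poly C}, [/\ P != 0, (forall i, S P`_i) & root P y].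

End AbsoluteValue.

(* The completion of an algebraic closure of K_oo, described up to isometric
   isomorphism over K = Fq(t): a complete, algebraically closed ultrametric
   field containing K with |a| = q ^ deg a for a in Fq[t], in which the
   elements algebraic over K_oo are dense. Since the field is complete, K_oo is
   the closure of K in it. *)
Structure Cinfty (Fq : finFieldType) (R : realType) := MkCinfty {
  Cfield :> closedFieldType;
  Cabs : Cfield -> R;
  ofK : {rmorphism rat_fun Fq -> Cfield};
  Cabs_ge0 : forall x, 0 <= Cabs x;
  Cabs_eq0 : forall x, Cabs x = 0 <-> x = 0;
  CabsM : forall x y, Cabs (x * y) = Cabs x * Cabs y;
  Cabs_ultra : forall x y, Cabs (x + y) <= Num.max (Cabs x) (Cabs y);
  Cabs_poly : forall a : {poly Fq}, a != 0 ->
    Cabs (ofK (FracField.tofrac a)) = #|Fq|%:R ^+ (size a).-1;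
  Ccomplete : forall u, abs_cauchy Cabs u -> exists l, abs_cvg Cabs u l;
  Calg_dense : forall x,
    abs_closure Cabs
      (algebraic_over (abs_closure Cabs (range ofK))) x
}.

Section DrinfeldCuspForms.
Variables (Fq : finFieldType) (R : realType) (C : Cinfty Fq R).

Definition Kinf : set C := abs_closure (@Cabs _ _ C) (range (@ofK _ _ C)).

Definition ofA (a : {poly Fq}) : C := ofK C (FracField.tofrac a).

Definition tC : C := ofA 'X.

(* P^1(C_oo) - P^1(K_oo), in the affine coordinate *)
Definition Omega : set C := ~` Kinf.

(* [C^o] is C as a module over itself, which makes this a C-vector space. *)
Definition Omega_fun := Omega -> C^o.

(* [insubd z] is the identification of Omega with a subtype: for g in
   GL_2(K_oo), the fraction lies in Omega and the default value z is unused. *)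
Definition mobius (g : 'M[C]_2) (z : Omega) : Omega :=
  insubd z ((g 0 0 * val z + g 0 1) / (g 1 0 * val z + g 1 1)).

Definition slash (k : nat) (m : int) (phi : Omega_fun) (g : 'M[C]_2) :
    Omega_fun :=
  fun z => phi (mobius g z) * (\det g) ^ m * (g 1 0 * val z + g 1 1) ^- k.

(* The affinoid |z| <= q^N, |z - x| >= q^-N for x in K_oo; these exhaust Omega *)
Definition Omega_affinoid (N : nat) : set Omega :=
  [set z | Cabs (val z) <= #|Fq|%:R ^+ N /\
           forall x, Kinf x -> #|Fq|%:R ^- N <= Cabs (val z - x)].

(* On each affinoid, a uniform limit of rational functions without poles *)
Definition rigid_analytic (phi : Omega_fun) : Prop :=
  forall (N : nat) (eps : R), 0 < eps ->
    exists P Q : {poly C}, forall z, Omega_affinoid N z ->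
      Q.[val z] != 0 /\ Cabs (phi z - P.[val z] / Q.[val z]) < eps.

(* Partial products of the exponential function of the lattice tFq[t], namely
   z * \prod_(0 != l in tFq[t]) (1 - z / l) *)
Definition exp_tA_partial (z : C) (d : nat) : C :=
  z * \prod_(v : 'rV[Fq]_d | v != 0) (1 - z / ofA ('X * rVpoly v)).

(* Expansion without constant term in u = 1 / exp_tA(z), valid for
   |z|_i = inf_(x in K_oo) |z - x| large *)
Definition vanishes_at_oo (phi : Omega_fun) : Prop :=
  exists (a : nat -> C) (r : R), forall z : Omega,
    (forall x, Kinf x -> r <= Cabs (val z - x)) ->
    exists2 e : C, abs_cvg (@Cabs _ _ C) (exp_tA_partial (val z)) e &
      abs_cvg (@Cabs _ _ C)
        (fun N => \sum_(1 <= i < N) a i * e^-1 ^+ i) (phi z).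

Definition GL2A : set 'M[{poly Fq}]_2 := [set g | g \in unitmx].

Definition Gamma0t : set 'M[{poly Fq}]_2 :=
  [set g | g \in unitmx /\ 'X %| g 1 0].

Definition mxA (g : 'M[{poly Fq}]_2) : 'M[C]_2 := map_mx ofA g.

(* GL_2(Fq[t]) is transitive on P^1(K), so the cusps of Gamma are all reached
   by moving oo with GL_2(Fq[t]). For Gamma = GL2A or Gamma0t the conjugates of
   Gamma contain the translations by tFq[t], so that u is a parameter at every
   cusp. *)
Definition cusp_forms (k : nat) (m : int) (Gamma : set 'M[{poly Fq}]_2) :
    set Omega_fun :=
  [set phi | [/\ rigid_analytic phi,
    (forall g, Gamma g -> slash k m phi (mxA g) = phi) &
    (forall g, GL2A g -> vanishes_at_oo (slash k m phi (mxA g)))]].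

Definition atkin_U (phi : Omega_fun) : Omega_fun :=
  fun z => \sum_(b : Fq) phi (mobius (mx2 1 (ofA b%:P) 0 tC) z).

Definition delta_1 (phi : Omega_fun) : Omega_fun := phi.

Definition delta_t (m : int) (phi : Omega_fun) : Omega_fun :=
  fun z => tC ^ m * phi (mobius (mx2 tC 0 0 1) z).

Definition oldforms (k : nat) (m : int) : set Omega_fun :=
  [set delta_1 phi + delta_t m psi |
    phi in cusp_forms k m GL2A & psi in cusp_forms k m GL2A].

Definition fricke (k : nat) (m : int) (phi : Omega_fun) : Omega_fun :=
  slash k m phi (mx2 0 (-1) tC 0).

Definition Tr (k : nat) (m : int) (phi : Omega_fun) : Omega_fun :=
  slash k m phi 1%:M +
  \sum_(b : Fq) slash k m phi (mx2 0 (-1) 1 (ofA b%:P)).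

Definition Tr' (k : nat) (m : int) (phi : Omega_fun) : Omega_fun :=
  Tr k m (fricke k m phi).

Definition newforms (k : nat) (m : int) : set Omega_fun :=
  [set phi | [/\ cusp_forms k m Gamma0t phi, Tr k m phi = 0 &
                 Tr' k m phi = 0]].

End DrinfeldCuspForms.

Arguments cusp_forms {Fq R} C k m Gamma _.
Arguments oldforms {Fq R} C k m _.
Arguments newforms {Fq R} C k m _.
Arguments atkin_U {Fq R} C phi _.
Arguments fricke {Fq R} C k m phi _.
Arguments GL2A Fq _ : clear implicits.
Arguments Gamma0t Fq _ : clear implicits.

(** * The matrices *)

(* Indices run over 'I_n, hence are shifted by one from the usual 1..n. *)
Section Matrices.
Variables (Fq : finFieldType) (R : realType) (C : Cinfty Fq R) (q j n : nat).

Definition matM : 'M[C]_n := \matrix_(a, b)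
  let top := (j + (n - a.+1) * (q - 1))%N in
  if a == b then (-1) ^+ j * 'C(top, j + a * (q - 1))%:R
  else - ('C(top, j + (n - b.+1) * (q - 1))%:R +
          (-1) ^+ j.+1 * 'C(top, j + b * (q - 1))%:R).

Definition s_exp (b : 'I_n) : nat := (j + 1 + b * (q - 1))%N.

Definition matD : 'M[C]_n := diag_mx (\row_b tC C ^+ s_exp b).

Definition matF : 'M[C]_n := \matrix_(a, b)
  if a == rev_ord b then (- tC C) ^+ s_exp b else 0.

Definition matA : 'M[C]_n := \matrix_(a, b)
  if a == rev_ord b then (-1) ^+ j.+1 else 0.

Definition matT : 'M[C]_n := 1%:M + matM *m matA.

End Matrices.

(* Main.v *)
From HB Require Import structures.
Require Import Defs.
From mathcomp Require Import ring zify finfield.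

(* By Lucas' theorem for base q digits, [T = 1 + M A] has the single nonzero row
   [w_b = (-1)^b C(n-1, b)] (b from 0), the first one; since [w_0 = 1], T is the
   idempotent [e_0 w] of rank one. Moreover [F = A D], so that [M A = T - 1],
   [M D = (T - 1) F], [F + M D = T F], and [F^2 = t^k]. Hence Ker(MA) and Ker(MD)
   are the lines through the first and the last basis vector, the newforms are
   the common kernel of w and wF, and these two linear forms restricted to the
   oldforms have determinant [(-t)^s_n - (-t)^s_1], which is nonzero. On the
   oldforms MD has two distinct eigenvalues; on the newforms MD = -F, with square
   t^k, is diagonalizable in odd characteristic, and only when it is scalar in
   characteristic 2. The basis vector e_1 shows that it is not scalar if n >= 4,
   and the space of newforms has dimension n - 2.

   For cusp forms, [Tr f = f + t^-m U_t(f^Fr)] expresses the trace by the two given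
   matrices. GL_2(Fq[t]) permutes Gamma_0(t) \ GL_2(Fq[t]) = P^1(Fq), so Tr f is
   invariant under GL_2(Fq[t]), and Tr f = (q + 1) f = f when f already is: the
   forms of level 1 are the fixed vectors of T. On them delta_t is the Fricke
   involution. *)

Set Implicit Arguments.
Unset Strict Implicit.
Unset Printing Implicit Defensive.

Import Order.TTheory GRing.Theory Num.Theory.
Local Open Scope classical_set_scope.
Local Open Scope ring_scope.

(** * Linear algebra *)

(** In an eigenbasis the assumption reads [(d_i - l)^2 y_i = 0] for each coordinate, and over a
    field this already gives [(d_i - l) y_i = 0]. *)
Lemma diagonalizable_generalized_eigen (K : fieldType) n (B : 'M[K]_n) l
    (x : 'cV[K]_n) :
  diagonalizable B -> (B - l%:M) *m ((B - l%:M) *m x) = 0 -> B *m x = l *: x.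
Proof.
case=> P uP /(diagonalizable_forLR uP)[d].
rewrite mxpoly.conjVmx // => ->.
have -> : invmx P *m diag_mx d *m P - l%:M =
    invmx P *m diag_mx (d - const_mx l) *m P.
  rewrite [in RHS]raddfB /= diag_const_mx mulmxBr mulmxBl mul_mx_scalar.
  by rewrite -scalemxAl mulVmx // scalemx1.
rewrite -!mulmxA mulKVmx // => h.
apply/eqP; rewrite -subr_eq0 -[l *: x](mulKmx uP) -mulmxBr; apply/eqP.
move/(congr1 (mulmx P)): h; rewrite mulKVmx // mulmx0 => h.
suff -> : diag_mx d *m (P *m x) - P *m (l *: x) = 0 by rewrite mulmx0.
rewrite -scalemxAr; apply/matrixP=> i k; move/matrixP/(_ i k)/eqP: h.
rewrite !mul_diag_mx !mxE -mulrBl !mulf_eq0 orbA orbb -mulf_eq0 => /eqP.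
by [].
Qed.

(** The minimal polynomial then divides a product of distinct linear factors. Writing that product
    as a fold acting on vectors lets later checks use a decomposition of [x]. *)
Lemma diagonalizable_annihilated (K : fieldType) n (B : 'M[K]_n.+1) rs :
  uniq rs -> (forall x, foldr (fun r (y : 'cV_n.+1) => B *m y - r *: y) x rs = 0) ->
  diagonalizable B.
Proof.
move=> urs kill; apply/mxpoly.diagonalizableP; exists rs => //.
apply: mxminpoly_min; apply/matrixP=> i k.
suff h (x : 'cV_n.+1) : horner_mx B (\prod_(r <- rs) ('X - r%:P)) *m x =
    foldr (fun r (y : 'cV_n.+1) => B *m y - r *: y) x rs.
  have /matrixP/(_ i 0) := h (delta_mx k 0).
  by rewrite kill -colE !mxE.
elim: rs {urs kill} => [|r rs IH]; first by rewrite big_nil rmorph1 mul1mx.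
rewrite big_cons rmorphM /= -mulmxA IH rmorphB /= horner_mx_X horner_mx_C.
by rewrite mulmxBl mul_scalar_mx.
Qed.

(** A single generator, possibly zero, replaces the choice of a basis; the zero generator
    corresponds to the empty basis. *)
Lemma dim_le1P (K : fieldType) (W : lmodType K) (V : set W) :
  (forall a v, V v -> V (a *: v)) ->
  dim_le V 1 <-> exists2 e, V e & forall v, V v -> exists a, v = a *: e.
Proof.
move=> VZ; split=> [[[|[|d]] [// _ [e [Ve eV]]]]|[e Ve gene]].
- exists 0 => [|v /eV[x [-> _]]]; first by have := Ve 0; rewrite /lin_comb big_ord0.
  by exists 0; rewrite /lin_comb big_ord0 scale0r.
- exists (e ord0) => [|v /eV[x [-> _]]].
    by have := Ve (const_mx 1); rewrite /lin_comb big_ord1 mxE scale1r.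
  by exists (x ord0 0); rewrite /lin_comb big_ord1.
have [e0|e_neq0] := eqVneq e 0.
  exists 0%N; split=> //; exists (fun=> 0); split=> [x|v /gene[a ->]].
    by rewrite /lin_comb big_ord0 -e0.
  exists 0; split=> [|x _]; first by rewrite /lin_comb big_ord0 e0 scaler0.
  by apply/matrixP => -[].
exists 1%N; split=> //; exists (fun=> e); split=> [x|v /gene[a ->]].
  by rewrite /lin_comb big_ord1; exact: VZ.
exists (const_mx a); rewrite /lin_comb; split=> [|x]; first by rewrite big_ord1 mxE.
rewrite big_ord1 => /eqP; rewrite -subr_eq0 -scalerBl scaler_eq0.
rewrite (negPf e_neq0) orbF subr_eq0 => /eqP ->.
by apply/matrixP=> i k; rewrite !ord1 mxE.
Qed.

(** * A rank one idempotent and an antidiagonal matrix *)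

Section RankOne.
Variables (K : fieldType) (N : nat).
Notation n := N.+2.
(** Intended values: [w_b = (-1)^b C(n-1, b)], [f_b = (-t)^s_b], [c = (-t)^k] and [N = j]. *)
Variables (w : 'rV[K]_n) (f : 'I_n -> K) (c : K).
Hypotheses (w0 : w 0 0 = 1) (wmax : w 0 ord_max ^+ 2 = 1).
Hypotheses (f_rev : forall b, f b * f (rev_ord b) = c) (c_neq0 : c != 0).
Hypothesis f0max : f 0 != f ord_max.

Notation e0 := (delta_mx 0 0 : 'cV[K]_n).
Notation emax := (delta_mx ord_max 0 : 'cV[K]_n).
Notation T := (e0 *m w).

Definition antidiag_mx : 'M[K]_n :=
  \matrix_(a, b) if a == rev_ord b then f b else 0.
Notation F := antidiag_mx.
Notation B := ((T - 1%:M) *m F).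
Notation old := (sum_set (Ker (T - 1%:M)) (Ker B)).
Notation new := (Ker T `&` (mulmx F @` Ker T)).

Let f_neq0 b : f b != 0.
Proof. by apply: contraNneq c_neq0 => z; rewrite -(f_rev b) z mul0r. Qed.

Lemma antidiag_mulE (x : 'cV[K]_n) i :
  (F *m x) i 0 = f (rev_ord i) * x (rev_ord i) 0.
Proof.
rewrite mxE (bigD1 (rev_ord i)) //= mxE rev_ordK eqxx big1 ?addr0 // => l ne.
by rewrite mxE -(inj_eq rev_ord_inj) rev_ordK eq_sym (negPf ne) mul0r.
Qed.

Lemma antidiag_sq : F *m F = c%:M.
Proof.
apply/matrixP=> i l; rewrite mxE (bigD1 (rev_ord i)) //= 2!mxE rev_ordK eqxx.
rewrite big1 ?addr0 => [|m ne]; last first.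
  by rewrite mxE -(inj_eq rev_ord_inj) rev_ordK eq_sym (negPf ne) mul0r.
rewrite (inj_eq rev_ord_inj) mxE; case: eqP => [<-|_]; last by rewrite mulr0.
by rewrite mulrC f_rev.
Qed.

Let FK (x : 'cV[K]_n) : F *m (F *m x) = c *: x.
Proof. by rewrite mulmxA antidiag_sq mul_scalar_mx. Qed.

Let mulTE (x : 'cV[K]_n) : T *m x = (w *m x) 0 0 *: e0.
Proof. by rewrite -mulmxA {1}[w *m x]mx11_scalar mul_mx_scalar. Qed.

Let e0_neq0 : e0 != 0.
Proof. by apply/eqP=> /matrixP/(_ 0 0)/eqP; rewrite !mxE oner_eq0. Qed.

Let KerTP (x : 'cV[K]_n) : Ker T x <-> (w *m x) 0 0 = 0.
Proof.
rewrite /Ker/= mulTE; split=> [/eqP|->]; last by rewrite scale0r.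
by rewrite scaler_eq0 (negPf e0_neq0) orbF => /eqP.
Qed.

Let we i : (w *m delta_mx i 0 : 'M_1) 0 0 = w 0 i.
Proof. by rewrite -colE mxE. Qed.

(** Since [w_0 = 1], [T] projects onto the line of [e0], and the fixed vectors of a projector form
    its image. *)
Lemma Ker_rank_one_sub1P (x : 'cV[K]_n) :
  Ker (T - 1%:M) x <-> exists a, x = a *: e0.
Proof.
rewrite /Ker/= mulmxBl mul1mx mulTE; split=> [/eqP|[a ->]].
  by rewrite subr_eq0 => /eqP e; eexists; rewrite -{1}e.
by rewrite -scalemxAr mxE we w0 mulr1 subrr.
Qed.

Let rev0 : rev_ord (0 : 'I_n) = ord_max.
Proof. by apply/val_inj; rewrite /= subn1. Qed.

Let revmax : rev_ord (ord_max : 'I_n) = 0.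
Proof. by rewrite -rev0 rev_ordK. Qed.

Let Fe i : F *m delta_mx i 0 = f i *: delta_mx (rev_ord i) (0 : 'I_1).
Proof.
apply/matrixP=> a b; rewrite ord1 antidiag_mulE !mxE eqxx !andbT.
rewrite -[a == _](inj_eq rev_ord_inj) rev_ordK.
by case: eqP => [->|_]; rewrite ?mulr0.
Qed.

(** [F] exchanges the lines of [e0] and [emax], so [F x] lies on the first exactly when [x] lies on
    the second. *)
Lemma Ker_rank_one_antidiagP (x : 'cV[K]_n) :
  Ker B x <-> exists a, x = a *: emax.
Proof.
rewrite -[Ker B x]/(B *m x = 0) -mulmxA -[_ = 0]/(Ker (T - 1%:M) (F *m x)).
rewrite Ker_rank_one_sub1P; split=> -[a h].
  (* Applying [F] to [F x = a e0] gives [c x = a f_0 emax]. *)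
  exists (a * f 0 / c); have := congr1 (mulmx F) h.
  rewrite FK -scalemxAr Fe rev0 scalerA => /(congr1 (GRing.scale c^-1)).
  by rewrite scalerA mulVf // scale1r => ->; rewrite scalerA mulrC.
by exists (a * f ord_max); rewrite h -scalemxAr Fe revmax scalerA.
Qed.

(** As [F^2 = c] is invertible, the inverse of [F] is [c^-1 F]; for a set stable under scaling,
    image and preimage under [F] agree. *)
Lemma image_antidiagP (x : 'cV[K]_n) (S : set 'cV[K]_n) :
  (forall a y, S y -> S (a *: y)) -> (mulmx F @` S) x <-> S (F *m x).
Proof.
move=> SZ; split=> [[y Sy <-]|SFx]; first by rewrite FK; exact: SZ.
exists (c^-1 *: (F *m x)); first exact: SZ.
by rewrite -scalemxAr FK scalerA mulVf // scale1r.
Qed.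

Let imageTP (x : 'cV[K]_n) : (mulmx F @` Ker T) x <-> Ker T (F *m x).
Proof.
apply: image_antidiagP => a y.
by rewrite /Ker/= -scalemxAr => ->; rewrite scaler0.
Qed.

Let newP (x : 'cV[K]_n) :
  new x <-> (w *m x) 0 0 = 0 /\ (w *m (F *m x)) 0 0 = 0.
Proof.
split=> [[/KerTP ? /imageTP/KerTP ?]//|[/KerTP ? /KerTP ?]].
by split=> //; apply/imageTP.
Qed.

(** [F + B = T F], whose kernel is the preimage of [Ker T] under [F]. *)
Lemma image_antidiag_KerT : mulmx F @` Ker T = Ker (F + B).
Proof.
have FB : F + B = T *m F by rewrite mulmxBl mul1mx addrC subrK.
apply/seteqP; split=> x.
  by move/imageTP; rewrite /Ker/= FB !mulmxA.
by rewrite /Ker/= FB => h; apply/imageTP; rewrite /Ker/= -h !mulmxA.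
Qed.

(** The form [w F] takes the value [f_0 w_max] on [e0], and [w_max] is nonzero because its square is
    1. *)
Lemma rank_one_Ker_disjoint : Ker (T - 1%:M) `&` (mulmx F @` Ker T) = [set 0].
Proof.
apply/seteqP; split=> [x [/Ker_rank_one_sub1P[a ->]]|x ->].
  move=> /imageTP/KerTP; rewrite -!scalemxAr Fe rev0 -scalemxAr 2!mxE we.
  move=> /eqP; rewrite !mulf_eq0 (negPf (f_neq0 _)) /=.
  case/orP => [/eqP-> //|/eqP z]; first by rewrite scale0r.
  by move: wmax; rewrite z expr0n => /eqP; rewrite eq_sym oner_eq0.
split; first by rewrite /Ker/= mulmx0.
by exists 0; rewrite ?mulmx0 // /Ker/= mulmx0.
Qed.

Lemma old_direct_sum : is_direct_sum old (Ker (T - 1%:M)) (Ker B).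
Proof.
split=> //; apply/seteqP; split=> x.
  case=> /Ker_rank_one_sub1P[a ->] /Ker_rank_one_antidiagP[b].
  move/matrixP/(_ 0 0); rewrite !mxE /= mulr1 mulr0 => ->.
  by rewrite scale0r.
by move=> ->; split; rewrite /Ker/= mulmx0.
Qed.

Let oldP x : old x <-> exists a b, x = a *: e0 + b *: emax.
Proof.
split=> [[y /Ker_rank_one_sub1P[a ->] [z /Ker_rank_one_antidiagP[b ->] <-]]|].
  by exists a, b.
move=> [a [b ->]]; exists (a *: e0); first by apply/Ker_rank_one_sub1P; exists a.
by exists (b *: emax) => //; apply/Ker_rank_one_antidiagP; exists b.
Qed.

Let wold a b : (w *m (a *: e0 + b *: emax)) 0 0 = a + b * w 0 ord_max.
Proof.
by rewrite mulmxDr -!scalemxAr mxE mxE [X in _ + X]mxE !we w0 mulr1.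
Qed.

Let wFold a b : (w *m (F *m (a *: e0 + b *: emax))) 0 0 =
  a * f 0 * w 0 ord_max + b * f ord_max.
Proof.
rewrite mulmxDr -!scalemxAr !Fe rev0 revmax !scalerA addrC wold addrC.
by [].
Qed.

(** The forms [w] and [w F] must agree on [y] and on its old part: a 2 by 2 linear system with
    determinant [f_max - f_0]. *)
Lemma old_new_decomp (y : 'cV[K]_n) :
  exists a b, new (y - (a *: e0 + b *: emax)).
Proof.
pose s := (w *m y) 0 0; pose u := (w *m (F *m y)) 0 0.
have d_neq0 : f ord_max - f 0 != 0 by rewrite subr_eq0 eq_sym.
(* Eliminating [a = s - b w_max] leaves [b (f_max - f_0) = u - w_max f_0 s], by [w_max^2 = 1]. *)
pose b := (u - w 0 ord_max * f 0 * s) / (f ord_max - f 0).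
exists (s - b * w 0 ord_max), b; apply/newP; split.
  by rewrite mulmxBr mxE [X in _ + X]mxE wold addrNK subrr.
rewrite !mulmxBr mxE [X in _ + X]mxE wFold -/u.
move: wmax @b; set v := w 0 ord_max => wm b.
have -> : (s - b * v) * f 0 * v + b * f ord_max =
    v * f 0 * s + b * (f ord_max - f 0) + b * f 0 * (1 - v ^+ 2) by ring.
by rewrite wm divfK //; ring.
Qed.

(** The intersection is trivial because the same system with zero right-hand side has only the zero
    solution. *)
Lemma old_new_direct_sum : is_direct_sum setT old new.
Proof.
split; apply/seteqP; split=> // x.
- move=> _; have [a [b nx]] := old_new_decomp x.
  exists (a *: e0 + b *: emax); first by apply/oldP; exists a, b.
  by exists (x - (a *: e0 + b *: emax)) => //; rewrite addrC subrK.
- case=> /oldP[a [b ->]] /newP[]; rewrite wold wFold => /eqP.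
  rewrite addr_eq0 => /eqP ->; move: wmax; set v := w 0 ord_max => wm.
  have -> : - (b * v) * f 0 * v + b * f ord_max =
    b * (f ord_max - f 0) + b * f 0 * (1 - v ^+ 2) by ring.
  rewrite wm subrr mulr0 addr0 => /eqP.
  rewrite mulf_eq0 subr_eq0 [f _ == _]eq_sym (negPf f0max) orbF => /eqP ->.
  by rewrite mul0r oppr0 !scale0r addr0.
- move=> ->; split; first by apply/oldP; exists 0, 0; rewrite !scale0r addr0.
  by apply/newP; rewrite !mulmx0 mxE.
Qed.

Let B_new x : new x -> B *m x = - (F *m x).
Proof.
move=> [_ /imageTP h].
by rewrite -mulmxA mulmxBl mul1mx (h : T *m _ = 0) sub0r.
Qed.

Let new_F x : new x -> new (F *m x).
Proof.
move=> /newP[wx wFx]; apply/newP; split=> //.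
by rewrite FK -scalemxAr mxE wx mulr0.
Qed.

Let newZ a x : new x -> new (a *: x).
Proof.
move=> /newP[wx wFx]; apply/newP; rewrite -!scalemxAr.
by split; rewrite mxE ?wx ?wFx mulr0.
Qed.

Let newB x y : new x -> new y -> new (x - y).
Proof.
move=> /newP[wx wFx] /newP[wy wFy]; apply/newP; rewrite !mulmxBr.
by split; rewrite mxE [X in _ + X]mxE ?wx ?wFx ?wy ?wFy subrr.
Qed.

(** The nonzero eigenvalue of [B] on the old space: [B] maps that space onto the line of
    [mu e0 - f_0 emax], on which it acts by [mu]. *)
Let mu := f 0 * w 0 ord_max.

Let B_old a b : B *m (B *m (a *: e0 + b *: emax)) =
  mu *: (B *m (a *: e0 + b *: emax)).
Proof.
have -> : B *m (a *: e0 + b *: emax) = (a * mu) *: e0 - (a * f 0) *: emax.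
  rewrite -mulmxA mulmxBl mul1mx mulTE wFold mulmxDr -!scalemxAr !Fe rev0 revmax.
  rewrite scalerDl !scalerA -mulrA.
  by rewrite -/mu opprD addrACA subrr addr0.
rewrite -mulmxA mulmxBl mul1mx mulTE -scaleNr wFold.
rewrite mulmxDr -!scalemxAr !Fe rev0 revmax.
rewrite !scalerA scalerDr !scalerA !scalerDl opprD.
rewrite addrACA subrr addr0 mulrN -scaleNr; congr (_ *: _ + _ *: _).
  by rewrite /mu; ring.
by rewrite /mu; ring.
Qed.

Let decomp x : exists2 v, new v & B *m (B *m (x - v)) = mu *: (B *m (x - v)).
Proof.
have [a [b nx]] := old_new_decomp x.
by exists (x - (a *: e0 + b *: emax)) => //; rewrite subKr B_old.
Qed.

Let BB_new x : new x -> B *m (B *m x) = c *: x.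
Proof. by move=> nx; rewrite (B_new nx) mulmxN (B_new (new_F nx)) opprK FK. Qed.

Let mu_sq : mu ^+ 2 = f 0 ^+ 2.
Proof. by rewrite exprMn wmax mulr1. Qed.

(** Here [mu^2 = f_0^2], whereas [c = f_0 f_max]. *)
Let mu_sq_neq : mu ^+ 2 != c.
Proof.
rewrite mu_sq -(f_rev 0) rev0 expr2 -subr_eq0 -mulrBr mulf_eq0.
by rewrite (negPf (f_neq0 _)) subr_eq0.
Qed.

Let mu_neq0 : mu != 0.
Proof. by rewrite -sqrf_eq0 mu_sq sqrf_eq0. Qed.

(** The roots are 0 and [mu] from the old space, [l] and [-l] from [B^2 = c] on the new space; they
    are distinct as [mu^2] differs from [c] and 2 is nonzero. *)
Lemma diagonalizable_rank_one l : (2%:R : K) != 0 -> l ^+ 2 = c ->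
  diagonalizable B.
Proof.
move=> two_neq0 l2; apply: (@diagonalizable_annihilated _ _ _ [:: 0; mu; l; - l]).
  have l_neq0 : l != 0 by rewrite -sqrf_eq0 l2.
  have l_neqN : l != - l by rewrite -addr_eq0 -mulr2n -mulr_natl mulf_neq0.
  have mu_neq y : y ^+ 2 = c -> mu != y.
    by move=> y2; apply: contraNneq mu_sq_neq => ->; rewrite y2.
  rewrite /= !inE !negb_or ![0 == _]eq_sym mu_neq0 oppr_eq0 l_neq0 l_neqN.
  by rewrite !mu_neq ?sqrrN.
move=> x; rewrite /= scale0r subr0 scaleNr opprK.
have [v nv] := decomp x; set o := x - v => Bo.
(* The factors for [l] and [-l] multiply to [B^2 - c], which kills the new part of [x] and leaves
   the old part [o]. *)
have -> : B *m (B *m x + l *: x) - l *: (B *m x + l *: x) =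
    B *m (B *m o) - c *: o.
  rewrite mulmxDr -scalemxAr scalerDr scalerA -expr2 l2 addrKA.
  by rewrite /o !mulmxBr (BB_new nv) scalerBr opprB addrA addrNK.
have BBo : B *m (B *m (B *m o) - c *: o) = (mu ^+ 2 - c) *: (B *m o).
  by rewrite Bo mulmxBr -!scalemxAr Bo scalerA scalerBl.
by rewrite mulmxBr -[in X in _ - X]scalemxAr BBo -scalemxAr Bo !scalerA mulrC subrr.
Qed.

(** On the new space [B = -F] is now the scalar [-l], so the roots 0, [mu] and [-l] suffice. *)
Lemma diagonalizable_rank_one_scalar l : l ^+ 2 = c ->
  (forall x, new x -> F *m x = l *: x) -> diagonalizable B.
Proof.
move=> l2 Fl; apply: (@diagonalizable_annihilated _ _ _ [:: 0; mu; - l]).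
  have l_neq0 : l != 0 by rewrite -sqrf_eq0 l2.
  rewrite /= !inE !negb_or ![0 == _]eq_sym mu_neq0 oppr_eq0 l_neq0 /= andbT.
  by apply: contraNneq mu_sq_neq => ->; rewrite sqrrN l2.
move=> x; rewrite /= scale0r subr0 scaleNr opprK.
have [v nv] := decomp x; set o := x - v => Bo.
have -> : B *m x + l *: x = B *m o + l *: o.
  by rewrite /o mulmxBr scalerBr addrACA -opprD (B_new nv) Fl // addNr subr0.
have BBo : B *m (B *m o + l *: o) = (mu + l) *: (B *m o).
  by rewrite mulmxDr -scalemxAr Bo scalerDl.
by rewrite mulmxBr -[in X in _ - X]scalemxAr BBo -scalemxAr Bo !scalerA mulrC subrr.
Qed.

(** The new part of the basis vector [e_1] differs from it only in the first and last coordinates,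
    while [F] moves index 1 to another inner index once [n >= 4]. *)
Lemma new_scalar_small l : (forall x, new x -> F *m x = l *: x) -> (N < 2)%N.
Proof.
move=> Fl; rewrite ltnNge; apply/negP => N2.
pose i : 'I_n := inord 1; have vi : i = 1%N :> nat by rewrite inordK.
have [a [b nx]] := old_new_decomp (delta_mx i 0).
(* At this coordinate the left side is [f_1] and the right side is 0. *)
move/matrixP/(_ (rev_ord i) 0)/eqP: (Fl _ nx).
rewrite antidiag_mulE rev_ordK !mxE eqxx !andbT /=.
have ordE (a' b' : 'I_n) : (a' == b') = (a' == b' :> nat) by [].
have -> : (i == 0) = false by rewrite ordE vi.
have -> : (i == ord_max) = false by rewrite ordE vi /=; lia.
have -> : (rev_ord i == i) = false by rewrite ordE /= vi; lia.
have -> : (rev_ord i == 0) = false by rewrite ordE /= vi; lia.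
have -> : (rev_ord i == ord_max) = false by rewrite ordE /= vi; lia.
by rewrite !mulr0 addr0 !subr0 mulr1 mulr0 (negPf (f_neq0 _)).
Qed.

(** With at most three coordinates, a new vector vanishing at index 1 is supported at the two ends,
    hence is old, hence is zero. *)
Lemma new_small : (N < 2)%N -> dim_le new 1.
Proof.
move=> N2; apply/dim_le1P; first exact: newZ.
(* For [N = 0] this index is the last one; the argument still applies. *)
pose i : 'I_n := inord 1; have vi : i = 1%N :> nat by rewrite inordK.
have new0 x : new x -> x i 0 = 0 -> x = 0.
  move=> nx xi; have [_ /seteqP[+ _]] := old_new_direct_sum.
  apply; split=> //; apply/oldP.
  exists (x 0 0), (x ord_max 0); apply/matrixP=> a b; rewrite ord1 !mxE !andbT.
  have [->|a0] := eqVneq a 0; first by rewrite mulr1 mulr0 addr0.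
  rewrite mulr0 add0r; have [->|amax] := eqVneq a ord_max; first by rewrite mulr1.
  rewrite mulr0 -xi; congr (x _ _); apply/val_inj.
  move: a0 amax; rewrite -!val_eqE /= vi; have := ltn_ord a; lia.
have [[e [ne ei]]|no] := pselect (exists e, new e /\ e i 0 != 0).
  exists e => // v nv; exists (v i 0 / e i 0); apply/eqP; rewrite -subr_eq0.
  apply/eqP/new0; last by rewrite !mxE divfK // subrr.
  by apply: newB => //; exact: newZ.
exists 0 => [|v nv].
  by apply/newP; rewrite !mulmx0 mxE.
exists 0; rewrite scale0r; apply: new0 => //; apply/eqP.
by apply: contra_notT no => vi0; exists v.
Qed.

(** [F] preserves the new space, so on a line it is a scalar whose square is [c]; on the zero space
    any root of [c] serves. *)
Lemma dim_new_diagonalizable l : l ^+ 2 = c -> dim_le new 1 -> diagonalizable B.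
Proof.
move=> l2 /(dim_le1P newZ)[e ne ge].
have [a Fe'] := ge _ (new_F ne).
have [e_eq0|e_neq0] := eqVneq e 0.
  apply: (diagonalizable_rank_one_scalar l2) => x /ge[b ->].
  by rewrite e_eq0 scaler0 mulmx0 scaler0.
apply: (@diagonalizable_rank_one_scalar a) => [|x /ge[b ->]]; last first.
  by rewrite -scalemxAr Fe' !scalerA mulrC.
have /eqP := FK e; rewrite Fe' -scalemxAr Fe' scalerA -subr_eq0 -scalerBl.
by rewrite scaler_eq0 (negPf e_neq0) orbF subr_eq0 => /eqP.
Qed.

(** In characteristic 2, [B^2 = c = l^2] on the new space gives [(B - l)^2 = 0] there. If [B] is
    diagonalizable this forces [B = l], so [F] is scalar and [n] is at most 3. *)
Lemma diagonalizable_dim_new l : (2%:R : K) = 0 -> l ^+ 2 = c ->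
  diagonalizable B <-> dim_le new 1.
Proof.
move=> two0 l2; split; last exact: dim_new_diagonalizable l2.
move=> dB; apply: new_small; apply: (@new_scalar_small (- l)) => x nx.
rewrite -[LHS]opprK -(B_new nx) scaleNr; congr (- _).
apply: (diagonalizable_generalized_eigen dB).
have sub_lE y : (B - l%:M) *m y = B *m y - l *: y.
  by rewrite mulmxBl mul_scalar_mx.
rewrite !sub_lE mulmxBr -scalemxAr (BB_new nx) scalerBr scalerA -expr2 l2 opprB.
by rewrite -mulr2n -scaler_nat two0 scale0r.
Qed.

End RankOne.

(** * The matrices *)

Lemma coef_XD1_exp (K : nzRingType) n i : (('X + 1 : {poly K}) ^+ n)`_i = 'C(n, i)%:R.
Proof.
rewrite exprD1n coef_sum.
under eq_bigr do rewrite coefMn coefXn.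
have [lin|lni] := ltnP i n.+1; last first.
  rewrite bin_small // big1 // => l _.
  by rewrite eqn_leq [(i <= l)%N]leqNgt (leq_trans (ltn_ord l) lni) mul0rn.
rewrite (bigD1 (Ordinal lin)) //= eqxx big1 ?addr0 // => l ne.
by rewrite -val_eqE /= eq_sym in ne; rewrite (negPf ne) mul0rn.
Qed.

(** * Binomial coefficients modulo p through base q digits *)

Section BinomialModP.
Variables (K : fieldType) (q : nat).
Hypothesis q_pchar : [pchar K].-nat q.

(** Compare coefficients in [(X + 1)^(N + q) = (X + 1)^N (X^q + 1)]. *)
Lemma bin_addq N M :
  'C(N + q, M)%:R = 'C(N, M)%:R + (if (q <= M)%N then 'C(N, M - q)%:R else 0) :> K.
Proof.
rewrite -!coef_XD1_exp exprD [X in _ * X](_ : _ = 'X^q + 1).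
  by rewrite mulrDr mulr1 coefD coefMXn addrC ltnNge if_neg.
rewrite exprDn_pchar ?expr1n //; apply: sub_in_pnat q_pchar => p _.
by rewrite pchar_poly.
Qed.

(** Adding [q] raises the upper digit by one, and [bin_addq] then acts as Pascal's rule on upper
    digits. *)
Lemma bin_lucas al be a b : (a < q)%N -> (b < q)%N ->
  'C(al * q + a, be * q + b)%:R = 'C(al, be)%:R * 'C(a, b)%:R :> K.
Proof.
move=> aq bq; elim: al be => [|al IH] [|be].
- by rewrite !mul0n !add0n bin0 mul1r.
- by rewrite bin0n mul0r add0n bin_small //; lia.
- have -> : (al.+1 * q + a = al * q + a + q)%N by lia.
  rewrite bin_addq mul0n add0n leqNgt bq addr0.
  by have := IH 0%N; rewrite mul0n add0n !bin0.
have -> : (al.+1 * q + a = al * q + a + q)%N by lia.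
rewrite bin_addq IH ifT; last lia.
have -> : (be.+1 * q + b - q = be * q + b)%N by lia.
by rewrite IH binS natrD mulrDl.
Qed.

(** The inner coefficients of [(X + 1)^q] vanish, so by Pascal's rule consecutive coefficients of
    [(X + 1)^(q-1)] are opposite. *)
Lemma bin_pred_q i : (i < q)%N -> 'C(q.-1, i)%:R = (-1) ^+ i :> K.
Proof.
elim: i => [|i IH] iq; first by rewrite bin0.
have := bin_addq 0 i.+1; rewrite add0n bin0n [(q <= _)%N]leqNgt iq addr0.
rewrite -{1}(prednK (leq_trans _ iq)) // binS natrD IH; last exact: ltnW.
by move/eqP; rewrite addr_eq0 => /eqP ->; rewrite exprS mulN1r.
Qed.

End BinomialModP.

(** * Explicit form of M, A, T and F *)

Section CuspMatrices.
Variables (Fq : finFieldType) (R : realType) (C : Cinfty Fq R) (q j : nat).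
Hypotheses (q_pchar : [pchar C].-nat q) (jq : (j.+1 < q)%N).
Notation n := j.+2.

(** For [x <= j] the base q digits of [j + x(q-1)] are [x] and [j - x], and
    [C(al, be) C(j-al, j-be)] vanishes unless [al = be]. For [be = j + 1] the lower argument is too
    large. *)
Let bin_top_lt al be : (al <= j)%N -> (be <= j.+1)%N ->
  'C(j + al * (q - 1), j + be * (q - 1))%:R = (al == be)%:R :> C.
Proof.
move=> alj bej; have digits x : (x <= j)%N -> (j + x * (q - 1) = x * q + (j - x))%N.
  by move=> xj; rewrite mulnBr muln1; have := @leq_pmulr x q; lia.
rewrite (digits al) //; have [be_le|] := leqP be j; last first.
  move=> j_lt; have -> : be = j.+1 by lia.
  by rewrite bin_small; [rewrite (_ : al == _ = false) //; lia | nia].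
rewrite (digits be) // (bin_lucas q_pchar); try lia.
case: (ltngtP al be) => [lt|lt|->]; first by rewrite (bin_small lt) mul0r.
  by rewrite (@bin_small (j - al)) ?mulr0 //; lia.
by rewrite !binn mulr1.
Qed.

(** The digits of the upper argument are [j] and [q - 1]. *)
Let bin_top_max be : (be <= j)%N ->
  'C(j + j.+1 * (q - 1), j + be * (q - 1))%:R = 'C(j, be)%:R * (-1) ^+ (j - be) :> C.
Proof.
move=> bej; have -> : (j + j.+1 * (q - 1) = j * q + q.-1)%N by nia.
have -> : (j + be * (q - 1) = be * q + (j - be))%N by nia.
rewrite (bin_lucas q_pchar); try lia.
by rewrite (bin_pred_q q_pchar) //; lia.
Qed.

Definition binom_row : 'rV[C]_n := \row_b ((-1) ^+ b * 'C(j.+1, b)%:R).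

(** Below the first row only the signed antidiagonal survives; the first row carries [w] in
    addition. *)
Lemma matME a b : matM C q j n a b =
  (if a == 0 then binom_row 0 b else 0) + (-1) ^+ j * (a == rev_ord b)%:R.
Proof.
rewrite !mxE /= !subSS.
have [->|a0] := eqVneq a 0; last first.
  have a_gt0 : (0 < a)%N by rewrite lt0n.
  rewrite add0r; have [<-|ab] := eqVneq a b.
    rewrite bin_top_lt; try (have := ltn_ord a; lia).
    by rewrite -val_eqE /= subSS eq_sym.
  have ltb := ltn_ord b.
  rewrite !bin_top_lt; try lia.
  have -> : (j.+1 - a == j.+1 - b)%N = false.
    by move: ab; rewrite -val_eqE /=; have := ltn_ord a; lia.
  rewrite add0r exprS mulN1r mulNr opprK -val_eqE /= subSS; congr (_ * _%:R).
  by have := ltn_ord a; lia.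
rewrite subn0 -val_eqE /=.
have -> : (0 == rev_ord b) = (0 == j.+1 - b)%N by rewrite -val_eqE /= subSS.
have [b0|b0] := eqVneq 0%N (b : nat).
  rewrite -b0 bin_top_max // bin0 subn0 mul1r bin0 expr0 mulr1 -signr_odd.
  by rewrite -expr2 sqrr_sign subn0 mulr0 addr0.
(* In the upper right corner the term [(-1)^(j+1)] of [w] cancels the antidiagonal sign. *)
have [bmax|] := eqVneq (b : nat) j.+1.
  rewrite bmax subnn bin_top_max // bin0 subn0 !binn !mul1r eqxx !mulr1.
  by rewrite exprS mulN1r subrr oppr0 addNr.
move=> bmax; have ltb := ltn_ord b.
have -> : (0 == j.+1 - b)%N = false by lia.
rewrite mulr0 addr0 !bin_top_max; try lia.
case: (nat_of_ord b) b0 bmax ltb => // b' _ bmax ltb.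
(* With [b = b' + 1], both binomials get the sign [(-1)^b'] and add up to [C(j+1, b)] by Pascal's
   rule. *)
rewrite subSS bin_sub; last lia.
rewrite (_ : (j - (j - b') = b')%N); last lia.
rewrite mulrCA [(-1) ^+ j.+1 * _]mulrC -exprD.
have -> : (-1) ^+ (j - b'.+1 + j.+1) = (-1) ^+ b' :> C.
  rewrite -[LHS]signr_odd -[RHS]signr_odd; congr (_ ^+ _); lia.
by rewrite -mulrDl [X in - (X * _)]addrC -natrD -binS exprS mulN1r mulNr mulrC.
Qed.

Lemma matAE a b : matA C j n a b = (-1) ^+ j.+1 * (a == rev_ord b)%:R.
Proof. by rewrite mxE; case: eqP => _; rewrite ?mulr1 ?mulr0. Qed.

Lemma mulmx_matA (X : 'M[C]_n) a b :
  (X *m matA C j n) a b = X a (rev_ord b) * (-1) ^+ j.+1.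
Proof.
rewrite mxE (bigD1 (rev_ord b)) //= matAE eqxx mulr1 big1 ?addr0 // => l ne.
by rewrite matAE (negPf ne) !mulr0.
Qed.

(** The antidiagonal part of [M] times [A] is [-1] and cancels the identity; the remaining row is
    [w] reversed with a sign, which is [w] by symmetry of the binomials. *)
Lemma matTE : matT C q j n = delta_mx 0 0 *m binom_row.
Proof.
apply/matrixP=> a b; rewrite !mxE big_ord1 !mxE andbT.
rewrite -[\sum_i _](_ : (matM C q j n *m matA C j n) a b = _); last by rewrite mxE.
rewrite mulmx_matA matME rev_ordK mulrDl.
rewrite [(-1) ^+ j * _ * _]mulrAC -exprD.
have -> : (-1) ^+ (j + j.+1) = -1 :> C.
  by rewrite -signr_odd addnS /= addnn odd_double.
rewrite mulN1r addrCA addrN addr0; case: eqP => _; last by rewrite !mul0r.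
rewrite mul1r mxE /= subSS mulrAC -exprD bin_sub //; last by rewrite -ltnS.
congr (_ * _); rewrite -[LHS]signr_odd -[RHS]signr_odd; congr (_ ^+ _).
by have := ltn_ord b; lia.
Qed.

Lemma matA_sq : matA C j n *m matA C j n = 1%:M.
Proof.
apply/matrixP=> a b; rewrite mulmx_matA matAE rev_ordK mulrAC -expr2 sqrr_sign.
by rewrite mul1r mxE.
Qed.

Hypothesis sign_q : (-1) ^+ (q - 1) = 1 :> C.

Lemma matFE : matF C q j n = matA C j n *m matD C q j n.
Proof.
apply/matrixP=> a b; rewrite mul_mx_diag !mxE; case: eqP => _; last by rewrite mul0r.
by rewrite -[- tC C]mulN1r exprMn /s_exp exprD mulnC exprM sign_q expr1n mulr1 addn1.
Qed.

End CuspMatrices.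

(** * The Drinfeld upper half plane *)

Section UpperHalfPlane.
Variables (Fq : finFieldType) (R : realType) (C : Cinfty Fq R).
Local Notation absC := (@Cabs Fq R C).
Local Notation KI := (@Kinf Fq R C).

HB.instance Definition _ :=
  GRing.RMorphism.copy (@ofA Fq R C) (ofK C \o @FracField.tofrac {poly Fq}).

Lemma Cabs0 : absC 0 = 0. Proof. exact/Cabs_eq0. Qed.

Lemma Cabs_gt0 (x : C) : x != 0 -> 0 < absC x.
Proof.
move=> x0; rewrite lt_neqAle Cabs_ge0 andbT eq_sym.
by apply: contra x0 => /eqP/Cabs_eq0 ->.
Qed.

Lemma Cabs1 : absC 1 = 1.
Proof.
have := @CabsM _ _ C 1 1; rewrite mulr1 -{1}[absC 1]mulr1 => /mulfI h.
by rewrite -h // gt_eqF // Cabs_gt0 // oner_eq0.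
Qed.

Lemma CabsN (x : C) : absC (- x) = absC x.
Proof.
have : absC (-1) ^+ 2 = 1 ^+ 2 by rewrite expr2 -CabsM mulrNN mulr1 Cabs1 expr1n.
move/eqP; rewrite eqrXn2 ?Cabs_ge0 // => /eqP h.
by rewrite -mulN1r CabsM h mul1r.
Qed.

Lemma CabsV (x : C) : x != 0 -> absC x^-1 = (absC x)^-1.
Proof.
move=> x0; have ax : absC x != 0 by rewrite gt_eqF // Cabs_gt0.
by apply/(mulfI ax); rewrite -CabsM !divff // Cabs1.
Qed.

Lemma CabsX (x : C) i : absC (x ^+ i) = absC x ^+ i.
Proof. by elim: i => [|i IH]; rewrite ?Cabs1 // !exprS CabsM IH. Qed.

Lemma CabsD_lt (x y : C) e : absC x < e -> absC y < e -> absC (x + y) < e.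
Proof. by move=> xe ye; apply: le_lt_trans (Cabs_ultra x y) _; rewrite gt_max xe. Qed.

Lemma Kinf_ofK a : KI (ofK C a).
Proof. by move=> e e0; exists (ofK C a); [exists a | rewrite subrr Cabs0]. Qed.

Lemma Kinf_ofA a : KI (ofA C a). Proof. exact: Kinf_ofK. Qed.

Lemma Kinf0 : KI 0. Proof. by rewrite -(rmorph0 (ofK C)); exact: Kinf_ofK. Qed.

Lemma Kinf1 : KI 1. Proof. by rewrite -(rmorph1 (ofK C)); exact: Kinf_ofK. Qed.

Lemma KinfB x y : KI x -> KI y -> KI (x - y).
Proof.
move=> Kx Ky e e0; have [_ [a _ <-] xa] := Kx e e0; have [_ [b _ <-] yb] := Ky e e0.
exists (ofK C (a - b)); first by exists (a - b).
have -> : x - y - ofK C (a - b) = (x - ofK C a) - (y - ofK C b).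
  by rewrite rmorphB /=; ring.
by apply: CabsD_lt; rewrite ?CabsN.
Qed.

Lemma KinfN x : KI x -> KI (- x).
Proof. by rewrite -sub0r; apply: KinfB Kinf0. Qed.

Lemma KinfD x y : KI x -> KI y -> KI (x + y).
Proof. by move=> Kx /KinfN Ky; rewrite -[y]opprK; exact: KinfB. Qed.

Lemma KinfM x y : KI x -> KI y -> KI (x * y).
Proof.
move=> Kx Ky e e0.
have pos (z : C) : 0 < 1 + absC z by rewrite ltr_wpDr ?Cabs_ge0.
have [_ [b _ <-] yb] := Ky (e / (1 + absC x)) (divr_gt0 e0 (pos _)).
(* The precision required for [x] depends on the approximation [b] already chosen for [y]. *)
have [_ [a _ <-] xa] := Kx (e / (1 + absC (ofK C b))) (divr_gt0 e0 (pos _)).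
exists (ofK C (a * b)); first by exists (a * b).
have -> : x * y - ofK C (a * b) = x * (y - ofK C b) + (x - ofK C a) * ofK C b.
  by rewrite rmorphM /=; ring.
have small (u v : C) : absC v < e / (1 + absC u) -> absC u * absC v < e.
  rewrite ltr_pdivlMr // mulrDr mulr1 mulrC; apply: le_lt_trans.
  by rewrite lerDr Cabs_ge0.
by apply: CabsD_lt; rewrite CabsM; [|rewrite mulrC]; exact: small.
Qed.

Lemma KinfV x : KI x -> KI x^-1.
Proof.
move=> Kx; have [->|x0] := eqVneq x 0; first by rewrite invr0; exact: Kinf0.
have px := Cabs_gt0 x0; move=> e e0.
(* The first bound forces [|a| >= |x|], so [a] is nonzero; the second gives
   [|x - a| / (|x||a|) < e]. *)
have [|_ [a _ <-]] := Kx (Num.min (absC x) (e * absC x ^+ 2)).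
  by rewrite lt_min px mulr_gt0 // exprn_gt0.
rewrite lt_min => /andP[xa1 xa2].
have ax : absC x <= absC (ofK C a).
  rewrite leNgt; apply/negP => ax; have := CabsD_lt xa1 ax.
  by rewrite addrNK ltxx.
have a0 : ofK C a != 0.
  by apply: contraTneq ax => ->; rewrite Cabs0 -ltNge.
exists (ofK C a^-1); first by exists a^-1.
rewrite fmorphV /=.
have -> : x^-1 - (ofK C a)^-1 = - (x - ofK C a) * (x^-1 * (ofK C a)^-1).
  by field; rewrite a0 x0.
rewrite !CabsM CabsN !CabsV // -invfM ltr_pdivrMr ?mulr_gt0 ?Cabs_gt0 //.
by apply: lt_le_trans xa2 _; rewrite ler_pM2l // expr2 ler_pM2l.
Qed.

Definition GL2Kinf : set 'M[C]_2 :=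
  [set g : 'M[C]_2 | (forall i l, KI (g i l)) /\ \det g != 0].

Lemma mx2_eta (T : Type) (g : 'M[T]_2) : g = mx2 (g 0 0) (g 0 1) (g 1 0) (g 1 1).
Proof.
apply/matrixP=> i l; rewrite mxE; case: i l => -[|[|//]] hi [[|[|//]] hl] /=;
  by congr (g _ _); apply/val_inj.
Qed.

Lemma det_mx22 (K : comNzRingType) (g : 'M[K]_2) :
  \det g = g 0 0 * g 1 1 - g 0 1 * g 1 0.
Proof.
rewrite (expand_det_row _ 0) !big_ord_recl big_ord0 addr0 /cofactor !det_mx11 !mxE /=.
rewrite expr0 expr1 mul1r mulN1r mulrN.
by congr (_ * g _ _ - g _ _ * g _ _); apply/val_inj.
Qed.

Lemma mx2_det (K : comNzRingType) (a b c d : K) : \det (mx2 a b c d) = a * d - b * c.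
Proof. by rewrite det_mx22 !mxE. Qed.

Lemma mulmx2E (K : comNzRingType) (g h : 'M[K]_2) i l :
  (g *m h) i l = g i 0 * h 0 l + g i 1 * h 1 l.
Proof.
rewrite mxE !big_ord_recl big_ord0 addr0.
by congr (_ + g _ _ * h _ _); apply/val_inj.
Qed.

Lemma GL2Kinf_mx2 a b c d : KI a -> KI b -> KI c -> KI d ->
  a * d - b * c != 0 -> GL2Kinf (mx2 a b c d).
Proof.
by move=> *; split; [move=> i l; rewrite mxE; do 2!case: ifP | rewrite mx2_det].
Qed.

Lemma GL2KinfM g h : GL2Kinf g -> GL2Kinf h -> GL2Kinf (g *m h).
Proof.
move=> [Kg g0] [Kh h0]; split=> [i l|]; last by rewrite det_mulmx mulf_neq0.
by rewrite mulmx2E; apply: KinfD; apply: KinfM.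
Qed.

(** A zero of [cz + d] would put [z = -d/c] in [K_oo]; if [c = 0], then [d] is nonzero by the
    determinant. *)
Lemma mobius_denom_neq0 g (z : @Omega Fq R C) : GL2Kinf g ->
  g 1 0 * val z + g 1 1 != 0.
Proof.
move=> [Kg]; rewrite det_mx22 => det_neq0; apply/eqP=> h.
have [c0|c0] := eqVneq (g 1 0) 0.
  by move: h det_neq0; rewrite c0 mul0r add0r => ->; rewrite !mulr0 subrr eqxx.
have := set_mem (valP z); apply.
have -> : val z = - g 1 1 / g 1 0.
  apply/(mulfI c0); rewrite mulrCA divff // mulr1.
  by apply/eqP; rewrite -addr_eq0 h.
by apply: KinfM; [apply: KinfN | apply: KinfV].
Qed.

(** The default value in [mobius] is never taken: if the image [y] were in [K_oo], so would be
    [z = (dy - b)/(a - cy)]. *)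
Lemma val_mobius g (z : @Omega Fq R C) : GL2Kinf g ->
  val (mobius g z) = (g 0 0 * val z + g 0 1) / (g 1 0 * val z + g 1 1).
Proof.
move=> Gg; have den := mobius_denom_neq0 z Gg; have [Kg] := Gg.
rewrite det_mx22 => det_neq0; rewrite /mobius val_insubd ifT //.
apply/mem_set => Ky; set y := _ / _ in Ky.
have := set_mem (valP z); apply.
have yE : y * (g 1 0 * val z + g 1 1) = g 0 0 * val z + g 0 1 by rewrite divfK.
clearbody y.
have zE : (g 0 0 - g 1 0 * y) * val z = g 1 1 * y - g 0 1.
  have -> : g 0 1 = y * (g 1 0 * val z + g 1 1) - g 0 0 * val z by rewrite yE; ring.
  ring.
(* If [a = cy], then also [b = dy], and the determinant vanishes. *)
have ne : g 0 0 - g 1 0 * y != 0.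
  apply: contraNneq det_neq0 => e0; move: zE; rewrite e0 mul0r => /esym/eqP.
  move/eqP: e0; rewrite !subr_eq0 => /eqP -> /eqP <-; apply/eqP; ring.
have -> : val z = (g 1 1 * y - g 0 1) / (g 0 0 - g 1 0 * y).
  by apply/(mulfI ne); rewrite zE mulrCA divff // mulr1.
by apply: KinfM; [|apply: KinfV]; apply: KinfB => //; apply: KinfM.
Qed.

(** Cocycle relation of the automorphy factor, which makes [slash] a right action. *)
Lemma mobius_denomM g h (z : @Omega Fq R C) : GL2Kinf g -> GL2Kinf h ->
  (g *m h) 1 0 * val z + (g *m h) 1 1 =
  (g 1 0 * val (mobius h z) + g 1 1) * (h 1 0 * val z + h 1 1).
Proof.
move=> Gg Gh; have den := mobius_denom_neq0 z Gh.
by rewrite val_mobius // !mulmx2E; field.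
Qed.

Lemma mobiusM g h (z : @Omega Fq R C) : GL2Kinf g -> GL2Kinf h ->
  mobius (g *m h) z = mobius g (mobius h z).
Proof.
move=> Gg Gh; have den := mobius_denom_neq0 z Gh.
have Ggh := GL2KinfM Gg Gh; have den2 := mobius_denom_neq0 (mobius h z) Gg.
apply/val_inj; rewrite val_mobius // [RHS]val_mobius // mobius_denomM //.
rewrite invfM mulrA mulrAC; congr (_ / _).
by rewrite val_mobius // !mulmx2E; field.
Qed.

Lemma slashM k m (phi : Omega_fun C) g h : GL2Kinf g -> GL2Kinf h ->
  slash k m (slash k m phi g) h = slash k m phi (g *m h).
Proof.
move=> Gg Gh; apply/funext => z; rewrite /slash mobiusM // mobius_denomM //.
by rewrite det_mulmx expfzMl exprMn invfM; ring.
Qed.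

Lemma mobius1 (z : @Omega Fq R C) : mobius 1%:M z = z.
Proof.
have G1 : GL2Kinf 1%:M.
  split=> [i l|]; last by rewrite det1 oner_eq0.
  by rewrite mxE; case: eqP => _; [exact: Kinf1 | exact: Kinf0].
by apply/val_inj; rewrite val_mobius // !mxE /= mul1r mul0r add0r addr0 divr1.
Qed.

Lemma slash1 k m (phi : Omega_fun C) : slash k m phi 1%:M = phi.
Proof.
apply/funext => z; rewrite /slash mobius1 det1 exp1rz !mxE /= mul0r add0r.
by rewrite expr1n invr1 !mulr1.
Qed.

Lemma slash_linear k m g a (phi psi : Omega_fun C) :
  slash k m (a *: phi + psi) g = a *: slash k m phi g + slash k m psi g.
Proof.
apply/funext=> z; rewrite /slash !fctE -[a *: phi _]/(a * phi _).
by rewrite -[a *: (_ / _)]/(a * (_ / _)) !mulrDl !mulrA.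
Qed.

Lemma slash_sum k m g I (r : seq I) (P : pred I) (phi : I -> Omega_fun C) :
  slash k m (\sum_(i <- r | P i) phi i) g = \sum_(i <- r | P i) slash k m (phi i) g.
Proof.
by apply/funext=> z; rewrite /slash !fct_sumE !mulr_suml.
Qed.

End UpperHalfPlane.

(** * Traces *)

Section ProjectiveLine.
Variable Fq : finFieldType.
Implicit Types g h u : 'M[Fq]_2.

(** The bottom row [(c : d)] as a point of P^1(Fq), with [None] for [c = 0]. *)
Definition bottom_class g : option Fq :=
  if g 1 0 == 0 then None else Some (g 1 1 / g 1 0).

Lemma bottom_classP g h : \det g != 0 -> \det h != 0 ->
  (bottom_class g = bottom_class h) <-> (g 1 0 * h 1 1 = g 1 1 * h 1 0).
Proof.
rewrite !det_mx22 /bottom_class => dg dh.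
have [g0|g0] := eqVneq (g 1 0) 0; have [h0|h0] := eqVneq (h 1 0) 0.
- by rewrite g0 h0 mul0r mulr0.
- rewrite g0 mul0r; split=> // /esym/eqP; rewrite mulf_eq0 (negPf h0) orbF => /eqP g1.
  by move: dg; rewrite g0 g1 !mulr0 subrr eqxx.
- rewrite h0 mulr0; split=> // /eqP; rewrite mulf_eq0 (negPf g0) /= => /eqP h1.
  by move: dh; rewrite h0 h1 !mulr0 subrr eqxx.
split=> [[/eqP]|e]; first by rewrite eqr_div // => /eqP ->; rewrite mulrC.
by congr Some; apply/eqP; rewrite eqr_div // -e mulrC.
Qed.

(** Right multiplication by [u] multiplies the cross product of the two bottom rows by [det u]. *)
Lemma bottom_class_mulr g h u : \det g != 0 -> \det h != 0 -> \det u != 0 ->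
  (bottom_class (g *m u) = bottom_class (h *m u)) <-> (bottom_class g = bottom_class h).
Proof.
move=> dg dh du; rewrite !bottom_classP ?det_mulmx ?mulf_neq0 //.
rewrite !mulmx2E; move: du; rewrite det_mx22 => du.
split=> e; apply/eqP; rewrite -subr_eq0; apply/eqP.
  apply: (mulIf du); rewrite mul0r; move/eqP: e; rewrite -subr_eq0 => /eqP <-; ring.
have -> : (g 1 0 * u 0 0 + g 1 1 * u 1 0) * (h 1 0 * u 0 1 + h 1 1 * u 1 1) -
    (g 1 0 * u 0 1 + g 1 1 * u 1 1) * (h 1 0 * u 0 0 + h 1 1 * u 1 0) =
    (g 1 0 * h 1 1 - g 1 1 * h 1 0) * (u 0 0 * u 1 1 - u 0 1 * u 1 0) by ring.
by rewrite e subrr mul0r.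
Qed.

Definition red (g : 'M[{poly Fq}]_2) : 'M[Fq]_2 := map_mx (horner_eval 0) g.

Lemma redM (g h : 'M[{poly Fq}]_2) : red (g *m h) = red g *m red h.
Proof. exact: map_mxM. Qed.

Lemma det_red_neq0 (g : 'M[{poly Fq}]_2) : g \in unitmx -> \det (red g) != 0.
Proof. by rewrite unitmxE => ug; rewrite det_map_mx -unitfE rmorph_unit. Qed.

Lemma Gamma0tE (g : 'M[{poly Fq}]_2) :
  Gamma0t Fq g <-> g \in unitmx /\ red g 1 0 = 0.
Proof.
rewrite /Gamma0t /= mxE /horner_eval -['X]subr0 -polyC0 dvdp_XsubCl.
by split=> -[ug /eqP h].
Qed.

Definition coset_rep (o : option Fq) : 'M[{poly Fq}]_2 :=
  if o is Some b then mx2 0 (-1) 1 b%:P else 1%:M.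

Lemma coset_rep_unit o : coset_rep o \in unitmx.
Proof.
case: o => [b|]; last exact: unitmx1.
by rewrite unitmxE mx2_det mul0r mulN1r opprK add0r unitr1.
Qed.

Lemma coset_repK o : bottom_class (red (coset_rep o)) = o.
Proof.
by case: o => [b|]; rewrite /bottom_class !mxE /horner_eval /= ?hornerE /=
  ?eqxx // oner_eq0 divr1.
Qed.

Lemma Gamma0t_same_class (g h : 'M[{poly Fq}]_2) :
  g \in unitmx -> h \in unitmx ->
  bottom_class (red g) = bottom_class (red h) -> Gamma0t Fq (g *m invmx h).
Proof.
move=> ug uh /(bottom_classP (det_red_neq0 ug) (det_red_neq0 uh)) e.
apply/Gamma0tE; split; first by rewrite unitmx_mul ug unitmx_inv.
have gE : red g = red (g *m invmx h) *m red h by rewrite -redM mulmxKV.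
(* Times [det (red h)], the lower left entry of [g h^-1] modulo t is the cross product of the bottom
   rows of [g] and [h]. *)
apply: (mulIf (det_red_neq0 uh)); rewrite mul0r det_mx22.
move/eqP: e; rewrite -subr_eq0 => /eqP <-; rewrite gE !mulmx2E; ring.
Qed.

End ProjectiveLine.

(** * The trace, its invariance and its relation to U_t and Fricke *)

Section Trace.
Variables (Fq : finFieldType) (R : realType) (C : Cinfty Fq R).
Variables (k : nat) (m : int).
Implicit Types phi psi : Omega_fun C.

Lemma GL2A_Kinf (g : 'M[{poly Fq}]_2) : g \in unitmx -> GL2Kinf (mxA C g).
Proof.
rewrite unitmxE => ug; split=> [i l|]; first by rewrite mxE; exact: Kinf_ofA.
by rewrite det_map_mx -unitfE rmorph_unit.
Qed.

Lemma mxAM (g h : 'M[{poly Fq}]_2) : mxA C (g *m h) = mxA C g *m mxA C h.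
Proof. exact: map_mxM. Qed.

Lemma tC_neq0 : tC C != 0.
Proof.
apply/eqP=> /Cabs_eq0 /eqP; rewrite /tC /ofA Cabs_poly ?polyX_eq0 //.
by rewrite size_polyX expr1 pnatr_eq0 (cardD1 0) inE.
Qed.

Lemma ofA_mx2_Kinf (a b c d : {poly Fq}) : a * d - b * c != 0 ->
  GL2Kinf (mx2 (ofA C a) (ofA C b) (ofA C c) (ofA C d)).
Proof.
move=> h; apply: GL2Kinf_mx2; try exact: Kinf_ofA.
by rewrite -!rmorphM -rmorphB fmorph_eq0 tofrac_eq0.
Qed.

Lemma TrE phi : Tr k m phi = \sum_o slash k m phi (mxA C (coset_rep o)).
Proof.
rewrite (bigD1 None) //= /Tr; congr (slash k m phi _ + _).
  by rewrite /mxA map_mx1.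
rewrite (reindex_omap Some id) /=; last by case.
apply: eq_big => [b|b _]; first by rewrite eqxx.
congr slash; rewrite /mxA; apply/matrixP=> i l; rewrite !mxE.
by do 2!case: ifP => _; rewrite ?rmorph0 ?rmorphN ?rmorph1.
Qed.

Lemma slash_same_class phi (g h : 'M[{poly Fq}]_2) :
  (forall u, Gamma0t Fq u -> slash k m phi (mxA C u) = phi) ->
  g \in unitmx -> h \in unitmx ->
  bottom_class (red g) = bottom_class (red h) ->
  slash k m phi (mxA C g) = slash k m phi (mxA C h).
Proof.
move=> inv ug uh same; have Gu := Gamma0t_same_class ug uh same.
have uu : g *m invmx h \in unitmx by case: Gu.
rewrite -[in LHS](mulmxKV uh g) mxAM -(slashM _ _ _ (GL2A_Kinf uu) (GL2A_Kinf uh)).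
by rewrite inv.
Qed.

Lemma Tr_invariant phi (u : 'M[{poly Fq}]_2) :
  (forall g, Gamma0t Fq g -> slash k m phi (mxA C g) = phi) ->
  u \in unitmx -> slash k m (Tr k m phi) (mxA C u) = Tr k m phi.
Proof.
move=> inv uu; rewrite TrE slash_sum.
(* Right multiplication by [u] induces this map on classes; being injective on a finite set, it
   permutes the summands. *)
pose s o := bottom_class (red (coset_rep o *m u)).
have s_inj : injective s.
  move=> o o' /eqP; rewrite /s !redM => /eqP/bottom_class_mulr h.
  by rewrite -[o]coset_repK h ?coset_repK ?det_red_neq0 ?coset_rep_unit.
rewrite [RHS](reindex_inj s_inj); apply: eq_bigr => o _.
rewrite (slashM _ _ _ (GL2A_Kinf (coset_rep_unit o)) (GL2A_Kinf uu)) -mxAM.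
apply: slash_same_class => //; first by rewrite unitmx_mul coset_rep_unit.
  exact: coset_rep_unit.
by rewrite coset_repK.
Qed.

Lemma Tr_GL2A phi : (#|Fq|%:R : C) = 0 ->
  (forall g, GL2A Fq g -> slash k m phi (mxA C g) = phi) -> Tr k m phi = phi.
Proof.
move=> q0 inv; rewrite TrE (eq_bigr (fun=> phi)) => [|o _]; last first.
  exact/inv/coset_rep_unit.
by rewrite sumr_const card_option mulrS -scaler_nat q0 scale0r addr0.
Qed.

(** The Fricke matrix times [(1 b; 0 t)] is [t (0 -1; 1 b)], with the same Moebius action as the
    representative; [t^-m] removes the factor [t^m] of the Fricke slash. *)
Lemma Tr_atkin_fricke phi :
  Tr k m phi = phi + tC C ^ (- m) *: atkin_U C (fricke C k m phi).
Proof.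
have t0 := tC_neq0.
rewrite /Tr slash1; congr (_ + _); apply/funext=> z.
rewrite fct_sumE fctE /atkin_U -[_ *: \sum_b _]/(_ * \sum_b _) mulr_sumr.
apply: eq_bigr => b _; rewrite /fricke /slash.
have Gf : GL2Kinf (mx2 0 (-1) (tC C) 0).
  have := @ofA_mx2_Kinf 0 (-1) 'X 0; rewrite rmorph0 rmorphN1; apply.
  by rewrite mul0r mulN1r opprK add0r polyX_eq0.
have Gb : GL2Kinf (mx2 0 (-1) 1 (ofA C b%:P)).
  have := @ofA_mx2_Kinf 0 (-1) 1 b%:P; rewrite rmorph0 rmorphN1 rmorph1; apply.
  by rewrite mul0r mulN1r opprK add0r oner_eq0.
have Gu : GL2Kinf (mx2 1 (ofA C b%:P) 0 (tC C)).
  have := @ofA_mx2_Kinf 1 b%:P 0 'X; rewrite rmorph0 rmorph1; apply.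
  by rewrite mul1r mulr0 subr0 polyX_eq0.
have vu : val (mobius (mx2 1 (ofA C b%:P) 0 (tC C)) z) = (val z + ofA C b%:P) / tC C.
  by rewrite val_mobius // !mxE /= mul1r mul0r add0r.
have vt : tC C * ((val z + ofA C b%:P) / tC C) = val z + ofA C b%:P.
  by rewrite mulrCA divff // mulr1.
have -> : mobius (mx2 0 (-1) (tC C) 0) (mobius (mx2 1 (ofA C b%:P) 0 (tC C)) z) =
    mobius (mx2 0 (-1) 1 (ofA C b%:P)) z.
  apply/val_inj; rewrite !val_mobius // !mxE /= !mul0r !add0r mul1r addr0.
  by rewrite vt.
rewrite !mx2_det !mxE /= vu addr0 vt mul1r !mul0r !mulN1r !sub0r !opprK exp1rz.
rewrite mulr1 [RHS]mulrA; congr (_ / _).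
by rewrite mulrCA -expfzDr // addNr mulr1.
Qed.

(** The Fricke matrix is [S diag(t, 1)] with [S] in GL_2(Fq[t]), and [diag(t, 1)] has automorphy
    factor 1 and determinant [t]. *)
Lemma delta_t_fricke psi :
  (forall g, GL2A Fq g -> slash k m psi (mxA C g) = psi) ->
  delta_t m psi = fricke C k m psi.
Proof.
have t0 := tC_neq0 => inv; apply/funext=> z.
have Gt : GL2Kinf (mx2 (tC C) 0 0 1).
  have := @ofA_mx2_Kinf 'X 0 0 1; rewrite rmorph0 rmorph1; apply.
  by rewrite mul0r mulr1 subr0 polyX_eq0.
pose S : 'M[{poly Fq}]_2 := mx2 0 (-1) 1 0.
have uS : S \in unitmx by rewrite unitmxE mx2_det mul0r mulN1r opprK add0r unitr1.
have -> : fricke C k m psi = slash k m (slash k m psi (mxA C S)) (mx2 (tC C) 0 0 1).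
  rewrite (slashM _ _ _ (GL2A_Kinf uS) Gt).
  congr slash; rewrite [LHS]mx2_eta [RHS]mx2_eta !mulmx2E !mxE /=.
  by rewrite rmorph0 rmorphN1 rmorph1 !(mul0r, mulr0, mul1r, mulr1, addr0, add0r).
rewrite inv // /slash /delta_t mx2_det !mxE /= !mul0r add0r expr1n invr1 !mulr1.
by rewrite subr0 mulrC.
Qed.

End Trace.

(** * Cusp forms in coordinates *)

Section Coordinates.
Variables (K : fieldType) (W : lmodType K) (V : set W) (n : nat) (e : 'I_n -> W).

Lemma lin_comb_linear a x y :
  lin_comb e (a *: x + y) = a *: lin_comb e x + lin_comb e y.
Proof.
rewrite /lin_comb scaler_sumr -big_split; apply: eq_bigr => i _ /=.
by rewrite !mxE scalerDl scalerA.
Qed.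

Lemma lin_comb0 : lin_comb e 0 = 0.
Proof. by rewrite /lin_comb big1 // => i _; rewrite mxE scale0r. Qed.

Lemma lin_combD x y : lin_comb e (x + y) = lin_comb e x + lin_comb e y.
Proof. by have := lin_comb_linear 1 x y; rewrite !scale1r. Qed.

Lemma lin_combZ a x : lin_comb e (a *: x) = a *: lin_comb e x.
Proof. by have := lin_comb_linear a x 0; rewrite lin_comb0 !addr0. Qed.

Lemma has_matrix_mulmx (L : W -> W) (B : 'M[K]_n) x :
  (forall a u v, L (a *: u + v) = a *: L u + L v) ->
  has_matrix e L B -> L (lin_comb e x) = lin_comb e (B *m x).
Proof.
move=> L_lin LB.
have L0 : L 0 = 0.
  by have := L_lin (-1) 0 0; rewrite scaler0 addr0 scaleN1r addNr.
have -> : B *m x = \sum_i x i 0 *: col i B.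
  apply/matrixP=> i l; rewrite ord1 mxE summxE; apply: eq_bigr => h _.
  by rewrite !mxE mulrC.
rewrite {1}/lin_comb; elim/big_rec2: _ => [|i y v _ IH]; first by rewrite lin_comb0.
by rewrite L_lin IH LB lin_combD lin_combZ.
Qed.

Hypothesis e_basis : is_basis V e.

Lemma is_basis_inj : injective (lin_comb e).
Proof.
move=> x y xy; have [Ve eV] := e_basis; have [z [_ z_uniq]] := eV _ (Ve x).
by rewrite -(z_uniq x) // -(z_uniq y).
Qed.

Lemma is_basis_direct_sum (X Y : set 'cV[K]_n) : is_direct_sum setT X Y ->
  is_direct_sum V (lin_comb e @` X) (lin_comb e @` Y).
Proof.
move=> [XYT XY0]; have [Ve eV] := e_basis; split; apply/seteqP; split=> v.
- move=> /eV[x [-> _]]; have : [set: 'cV[K]_n] x by [].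
  rewrite XYT => -[y Xy [z Yz <-]]; exists (lin_comb e y); first by exists y.
  by exists (lin_comb e z); [exists z | rewrite lin_combD].
- by move=> [_ [y _ <-] [_ [z _ <-] <-]]; rewrite -lin_combD; exact: Ve.
- move=> [[y Xy <-] [z Yz /is_basis_inj zy]]; subst z.
  have : (X `&` Y) y by [].
  by rewrite XY0 => ->; exact: lin_comb0.
- move=> ->; have [X0 Y0] : (X `&` Y) 0 by rewrite XY0.
  by split; exists 0 => //; exact: lin_comb0.
Qed.

Lemma is_basis_dim_le1 (X : set 'cV[K]_n) : (forall a x, X x -> X (a *: x)) ->
  dim_le (lin_comb e @` X) 1 <-> dim_le X 1.
Proof.
move=> XZ; rewrite !dim_le1P //; last first.
  by move=> a _ [x Xx <-]; exists (a *: x); [exact: XZ | rewrite lin_combZ].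
split=> [[_ [x Xx <-] gen]|[x Xx gen]].
  exists x => // y Xy; have [|a] := gen (lin_comb e y); first by exists y.
  by rewrite -lin_combZ => /is_basis_inj; exists a.
exists (lin_comb e x) => [|_ [y Xy <-]]; first by exists x.
by have [a ->] := gen _ Xy; exists a; rewrite lin_combZ.
Qed.

End Coordinates.

(** * Level one forms, oldforms and newforms in coordinates *)

Section CuspFormMatrices.
Variables (Fq : finFieldType) (R : realType) (C : Cinfty Fq R) (k : nat) (m : int).
Variables (n : nat) (F B T : 'M[C]_n) (c : 'I_n -> Omega_fun C).
Hypothesis c_basis : is_basis (cusp_forms C k m (Gamma0t Fq)) c.
Hypothesis U_mx : has_matrix c (atkin_U C) B.
Hypothesis fricke_mx : has_matrix c (fricke C k m) (tC C ^ (m - k%:Z) *: F).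
Hypothesis F_sq : F *m F = (tC C ^+ k)%:M.
Hypothesis BE : B = (T - 1%:M) *m F.
Hypothesis card_Fq : (#|Fq|%:R : C) = 0.

Lemma fricke_lin_comb x : fricke C k m (lin_comb c x) =
  lin_comb c (tC C ^ (m - k%:Z) *: (F *m x)).
Proof.
rewrite scalemxAl; apply: has_matrix_mulmx fricke_mx => a u v.
exact: slash_linear.
Qed.

Lemma atkin_lin_comb x : atkin_U C (lin_comb c x) = lin_comb c (B *m x).
Proof.
apply: has_matrix_mulmx U_mx => a u v; apply/funext=> z.
rewrite /atkin_U !fctE /= scaler_sumr -big_split; exact: eq_bigr.
Qed.

(** The trace formula gives the matrix [1 + t^-k B F], and [B F = (T - 1) F^2 = t^k (T - 1)]. *)
Lemma Tr_lin_comb x : Tr k m (lin_comb c x) = lin_comb c (T *m x).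
Proof.
have t0 := tC_neq0 C.
rewrite Tr_atkin_fricke fricke_lin_comb atkin_lin_comb -scalemxAr lin_combZ.
rewrite scalerA -expfzDr // addrA addNr add0r -lin_combZ -lin_combD; congr lin_comb.
rewrite BE -mulmxA [F *m (F *m x)]mulmxA F_sq mul_scalar_mx -scalemxAr scalerA.
by rewrite exprnP -expfzDr // addNr expr0z scale1r mulmxBl mul1mx addrC subrK.
Qed.

Lemma Tr'_lin_comb x : Tr' k m (lin_comb c x) =
  lin_comb c (tC C ^ (m - k%:Z) *: (T *m (F *m x))).
Proof. by rewrite /Tr' fricke_lin_comb Tr_lin_comb -scalemxAr. Qed.

Lemma newforms_lin_comb : newforms C k m =
  lin_comb c @` (Ker T `&` [set x | Ker T (F *m x)]).
Proof.
have tz : tC C ^ (m - k%:Z) != 0 by rewrite expfz_neq0 // tC_neq0.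
have inj := is_basis_inj c_basis; have [Vc cV] := c_basis.
apply/seteqP; split=> [phi [/cV[x [-> _]]]|_ [x [Tx TFx] <-]].
  rewrite Tr_lin_comb Tr'_lin_comb -[0 in X in X -> _](lin_comb0 c) => /inj Tx.
  rewrite -[0](lin_comb0 c) => /inj/eqP; rewrite scaler_eq0 (negPf tz) => /eqP TFx.
  by exists x.
split; [exact: Vc | rewrite Tr_lin_comb Tx; exact: lin_comb0 |].
by rewrite Tr'_lin_comb (TFx : T *m _ = 0) scaler0 lin_comb0.
Qed.

Lemma cusp_forms_GL2A_sub :
  cusp_forms C k m (GL2A Fq) `<=` cusp_forms C k m (Gamma0t Fq).
Proof. by move=> phi [? inv ?]; split=> // g [ug _]; exact: inv. Qed.

Lemma cusp_forms_GL2A_lin_comb :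
  cusp_forms C k m (GL2A Fq) = lin_comb c @` Ker (T - 1%:M).
Proof.
have inj := is_basis_inj c_basis; have [Vc cV] := c_basis.
apply/seteqP; split=> [phi Sphi|_ [x Tx <-]].
  have [x [phiE _]] := cV _ (cusp_forms_GL2A_sub Sphi); exists x => //.
  have [_ inv _] := Sphi; have := Tr_GL2A card_Fq inv.
  by rewrite phiE Tr_lin_comb => /inj Tx; rewrite /Ker/= mulmxBl Tx mul1mx subrr.
have TrE : Tr k m (lin_comb c x) = lin_comb c x.
  move: Tx; rewrite Tr_lin_comb /Ker/= mulmxBl mul1mx => /eqP.
  by rewrite subr_eq0 => /eqP ->.
(* Analyticity and the cusp conditions are the same for both groups; only the invariance has to be
   upgraded. *)
have [rig inv van] := Vc x; split=> // g ug.
by rewrite -TrE; exact: Tr_invariant.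
Qed.

Lemma oldforms_lin_comb : oldforms C k m =
  lin_comb c @` sum_set (Ker (T - 1%:M)) (mulmx F @` Ker (T - 1%:M)).
Proof.
have tz : tC C ^ (m - k%:Z) != 0 by rewrite expfz_neq0 // tC_neq0.
have delta_tE psi x : cusp_forms C k m (GL2A Fq) psi -> psi = lin_comb c x ->
    delta_t m psi = lin_comb c (F *m (tC C ^ (m - k%:Z) *: x)).
  by move=> [_ inv _] psiE; rewrite (delta_t_fricke inv) psiE fricke_lin_comb scalemxAr.
rewrite /oldforms; apply/seteqP; split=> [_ [phi Sphi [psi Spsi <-]]|].
  move: (Sphi) (Spsi); rewrite cusp_forms_GL2A_lin_comb => -[x Tx xE] [y Ty yE].
  rewrite (delta_tE _ _ Spsi (esym yE)) /delta_1 -xE -lin_combD.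
  eexists; last by []; exists x => //; eexists; last by [].
  by eexists; last by []; rewrite /Ker/= -scalemxAr Ty scaler0.
move=> _ [_ [x Tx [_ [y Ty <-] <-]] <-].
have Sx : cusp_forms C k m (GL2A Fq) (lin_comb c x).
  by rewrite cusp_forms_GL2A_lin_comb; exists x.
(* The rescaling compensates the factor [t^(m-k)] of the Fricke matrix. *)
have Sy : cusp_forms C k m (GL2A Fq) (lin_comb c ((tC C ^ (m - k%:Z))^-1 *: y)).
  rewrite cusp_forms_GL2A_lin_comb; eexists; last by [].
  by rewrite /Ker/= -scalemxAr Ty scaler0.
exists (lin_comb c x) => //; eexists; first exact: Sy.
by rewrite (delta_tE _ _ Sy erefl) scalerA divff // scale1r lin_combD.
Qed.

End CuspFormMatrices.

(** * Characteristic of C_oo and powers of t *)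

Section CharacteristicP.
Variables (p r q : nat) (Fq : finFieldType) (R : realType) (C : Cinfty Fq R).
Hypotheses (p_prime : prime p) (r_gt0 : (0 < r)%N) (qE : q = (p ^ r)%N).
Hypothesis card_q : #|Fq| = q.

Lemma Cinfty_pchar : p \in [pchar C].
Proof.
have pF : p \in [pchar Fq] by apply: (@card_finPcharP _ _ r) => //; rewrite -qE.
by apply: (rmorph_pchar (@ofA Fq R C)); rewrite pchar_poly.
Qed.

Lemma Cinfty_q_pchar : [pchar C].-nat q.
Proof.
rewrite qE pnatX; apply/orP; left; apply: sub_in_pnat (pnat_id p_prime) => s _.
by rewrite inE => /eqP ->; exact: Cinfty_pchar.
Qed.

Lemma Cinfty_card0 : #|Fq|%:R = 0 :> C.
Proof. by rewrite card_q qE natrX (pcharf0 Cinfty_pchar) expr0n gtn_eqF. Qed.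

Lemma Cinfty_two_odd : odd q -> 2%:R != 0 :> C.
Proof.
rewrite qE oddX => odd_p; apply/negP => /eqP two0.
have : 2%N \in [pchar C] by rewrite inE /= two0 eqxx.
rewrite (pcharf_eq Cinfty_pchar) inE => /eqP p2.
by move: odd_p; rewrite -p2 /= orbF eqn0Ngt r_gt0.
Qed.

Lemma Cinfty_two_even : ~~ odd q -> 2%:R = 0 :> C.
Proof.
rewrite qE oddX negb_or => /andP[_ even_p].
have := even_prime p_prime; rewrite (negPf even_p) => -[p2|//].
by have := pcharf0 Cinfty_pchar; rewrite p2.
Qed.

Lemma Cinfty_sign_pred_q : (-1) ^+ (q - 1) = 1 :> C.
Proof.
rewrite -signr_odd; have [oq|eq] := boolP (odd q).
  by rewrite oddB ?oq ?odd_gt0.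
have two0 := Cinfty_two_even eq.
have -> : -1 = 1 :> C by apply/eqP; rewrite eq_sym -addr_eq0 -mulr2n two0.
by rewrite expr1n.
Qed.

(** Distinct powers have distinct absolute values, as [|t| = q > 1]. *)
Lemma tC_neg_exp_inj : injective (fun i => (- tC C) ^+ i).
Proof.
move=> i l /(congr1 (@Cabs Fq R C)); rewrite !CabsX CabsN.
have -> : Cabs (tC C) = q%:R.
  by rewrite /tC /ofA Cabs_poly ?polyX_eq0 // size_polyX expr1 card_q.
have q1 : (1 < q%:R :> R) by rewrite ltr1n qE -(exp1n r) ltn_exp2r // prime_gt1.
by apply/ieexprIn; rewrite ?gt_eqF // (lt_trans ltr01).
Qed.

End CharacteristicP.

Theorem corollary5p13 (p r q : nat) (hp : prime p) (hr : (0 < r)%N)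
  (hq : q = (p ^ r)%N) (Fq : finFieldType) (hFq : #|Fq| = q)
  (R : realType) (C : Cinfty Fq R) (j n k : nat) (m : int)
  (hj : (j <= q - 2)%N) (hn : n = (j + 2)%N)
  (hk : k = (2 * j + 2 + (n - 1) * (q - 1))%N)
  (hm : (m = (j + 1)%N%:Z %[mod (q - 1)%N%:Z])%Z) :
  let M := matM C q j n in
  let D := matD C q j n in
  let F := matF C q j n in
  let A := matA C j n in
  let T := matT C q j n in
  let mxold := sum_set (Ker (M *m A)) (Ker (M *m D)) in
  let mxnew := Ker T `&` (mulmx F @` Ker T) in
  [/\ (* 1 *)
      (Ker (M *m A) `&` Ker (F + M *m D) =
         Ker (M *m A) `&` (mulmx F @` Ker (1%:M + M *m A))) /\
      Ker (M *m A) `&` (mulmx F @` Ker (1%:M + M *m A)) = [set 0],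
      (* 2, in terms of matrices *)
      (odd q -> diagonalizable (M *m D)) /\
      (~~ odd q -> (diagonalizable (M *m D) <-> dim_le mxnew 1)),
      (* 3, in terms of matrices *)
      is_direct_sum mxold (Ker (M *m A)) (Ker (M *m D)) /\
      is_direct_sum setT mxold mxnew &
      (* 2 and 3 for cusp forms, identified with column vectors by a basis in
         which U_t and the Fricke involution have their stated matrices *)
      forall c : 'I_n -> Omega_fun C,
        is_basis (cusp_forms C k m (Gamma0t Fq)) c ->
        has_matrix c (atkin_U C) (M *m D) ->
        has_matrix c (fricke C k m) (tC C ^ (m - k%:Z) *: F) ->
        [/\ ~~ odd q ->
              (diagonalizable (M *m D) <-> dim_le (newforms C k m) 1),
            is_direct_sum (cusp_forms C k m (Gamma0t Fq))
              (oldforms C k m) (newforms C k m),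
            oldforms C k m = lin_comb c @` mxold &
            newforms C k m = lin_comb c @` mxnew]].
Proof.
move=> M D F A T mxold mxnew; rewrite addn2 in hn; subst n.
have q_gt1 : (1 < q)%N by rewrite hq -(exp1n r) ltn_exp2r // prime_gt1.
have jq : (j.+1 < q)%N by lia.
have q_pchar := Cinfty_q_pchar C hp hq hFq.
have sign_q := Cinfty_sign_pred_q C hp hq hFq.
have card0 := Cinfty_card0 C hp hr hq hFq.
pose w := binom_row C j; pose f b := (- tC C) ^+ s_exp q j (b : 'I_j.+2).
have TE : T = delta_mx 0 0 *m w := matTE q_pchar jq.
have MAE : M *m A = T - 1%:M by rewrite /T /matT addrC addKr.
have FE : F = antidiag_mx f by [].
(* By [A^2 = 1], [M D = (M A)(A D)]. *)
have BE : M *m D = (T - 1%:M) *m F.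
  rewrite -MAE /F (matFE _ sign_q) -mulmxA [A *m _]mulmxA.
  by rewrite (matA_sq C j) mul1mx.
have w0 : w 0 0 = 1 by rewrite mxE bin0 mulr1.
have wmax : w 0 ord_max ^+ 2 = 1 by rewrite mxE binn mulr1 sqrr_sign.
pose c := (- tC C) ^+ k.
have c_neq0 : c != 0 by rewrite expf_neq0 // oppr_eq0 tC_neq0.
(* The exponents satisfy [s_b + s_(rev b) = 2(j+1) + (n-1)(q-1) = k]. *)
have f_rev b : f b * f (rev_ord b) = c.
  rewrite -exprD; congr (_ ^+ _); rewrite hk /s_exp /= subSS.
  have := ltn_ord b; rewrite ltnS => bj.
  have : (b * (q - 1) + (j.+1 - b) * (q - 1) = j.+1 * (q - 1))%N.
    by rewrite -mulnDl subnKC.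
  lia.
have f0max : f 0 != f ord_max.
  apply/eqP=> /(tC_neg_exp_inj hp hr hq hFq); rewrite /s_exp /=; nia.
(* The square root of [c] exists because the field is algebraically closed. *)
have [l l2] : exists l : C, l ^+ 2 = c.
  have [l lE] := @GRing.solve_monicpoly C 2 (fun i => if i == 0 then c else 0) isT.
  by exists l; rewrite lE !big_ord_recl big_ord0 /= mulr1 mul0r !addr0.
have mxoldE : mxold = sum_set (Ker (T - 1%:M)) (Ker ((T - 1%:M) *m F)).
  by rewrite /mxold MAE BE.
have dim_new : ~~ odd q -> diagonalizable (M *m D) <-> dim_le mxnew 1.
  move=> even_q; rewrite BE /mxnew FE TE.
  exact: (diagonalizable_dim_new w0 wmax f_rev c_neq0 f0max
    (Cinfty_two_even C hp hq hFq even_q) l2).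
have direct : is_direct_sum setT mxold mxnew.
  rewrite mxoldE /mxnew FE TE.
  exact: (old_new_direct_sum w0 wmax f_rev c_neq0 f0max).
split.
- rewrite MAE BE -/T [1%:M + _]addrC subrK.
  split; rewrite FE TE; last exact: (rank_one_Ker_disjoint w0 wmax f_rev c_neq0).
  by rewrite (image_antidiag_KerT _ f_rev c_neq0).
- split=> // odd_q; rewrite BE FE TE.
  exact: (diagonalizable_rank_one w0 wmax f_rev c_neq0 f0max
    (Cinfty_two_odd C hp hr hq hFq odd_q) l2).
- split=> //; rewrite /mxold MAE BE FE TE.
  exact: (old_direct_sum w0 f_rev c_neq0).
move=> e e_basis U_mx fr_mx.
(* The sign [(-1)^k] is 1, so [c = t^k]. *)
have F_sq : F *m F = (tC C ^+ k)%:M.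
  rewrite FE (antidiag_sq f_rev) /c -[- tC C]mulN1r exprMn hk.
  rewrite exprD [((j.+2 - 1) * _)%N]mulnC exprM sign_q expr1n mulr1.
  by rewrite -signr_odd oddD oddM mul1r.
have imP (X : 'M_j.+2) x : (mulmx F @` Ker X) x <-> Ker X (F *m x).
  apply: (image_antidiagP f_rev c_neq0) => a y.
  by rewrite /Ker /= -scalemxAr => ->; rewrite scaler0.
(* This identifies the image of [delta_t], namely the Fricke image of the level one forms, with
   [Ker(MD)]. *)
have KerBE : Ker (M *m D) = mulmx F @` Ker (T - 1%:M).
  by apply/seteqP; split=> x; rewrite imP BE /Ker /= mulmxA.
have mxnewE : mxnew = Ker T `&` [set x | Ker T (F *m x)].
  by congr (_ `&` _); apply/seteqP; split=> x /imP.
have oldE : oldforms C k m = lin_comb e @` mxold.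
  rewrite (oldforms_lin_comb e_basis U_mx fr_mx F_sq BE card0).
  by rewrite /mxold KerBE MAE.
have newE : newforms C k m = lin_comb e @` mxnew.
  by rewrite (newforms_lin_comb e_basis U_mx fr_mx F_sq BE) mxnewE.
split=> //.
  move=> even_q; rewrite dim_new // newE; apply: iff_sym.
  apply: (is_basis_dim_le1 e_basis) => a x; rewrite mxnewE /Ker /= -!scalemxAr.
  by move=> [-> ->]; rewrite !scaler0.
by rewrite oldE newE; exact: is_basis_direct_sum.
Qed.
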